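(* Let $X$ be an infinite-dimensional separable real Banach space endowed with a centered non-degenerate Gaussian measure $\gamma$, with Cameron–Martin space $H$, and let $\Omega\subset X$ be an open set. The Ornstein–Uhlenbeck semigroup $(T^\Omega(t))_{t\ge0}$ in $L^2(\Omega,\gamma)$ is sub-markovian, that is: for all $\varphi\in L^2(\Omega,\gamma)$ such that $0\le\varphi\le 1$ a.e. in $\Omega$ and for all $t\geq0$ we have $0\leq (T^{\Omega}(t)\varphi)(x) \leq 1$ for a.e. $x\in\Omega$.
   Context: Cameron–Martin space: $X^*_\gamma$ is the closure of $X^*$ in $L^2(X,\gamma)$; $R_\gamma:X^*_\gamma\to X$ is determined by $g(R_\gamma f)=\int_X f g\,d\gamma$ for all $g\in X^*$; $H=R_\gamma(X^*_\gamma)$. For $h\in H$, $\hat h\in X^*_\gamma$ is the element with $h=R_\gamma\hat h$, and $\langle h,k\rangle_H=\int_X\hat h\,\hat k\,d\gamma$. $H$ is a separable Hilbert space continuously embedded in $X$. Cylindrical functions: $\mathcal{F}C^k_b(X)$ is the set of functions $f(x)=\varphi(l_1(x),\ldots,l_n(x))$ with $n\in\mathbb N$, $\varphi\in C^k_b(\mathbb R^n)$, $l_i\in X^*$; $\mathcal{F}C^k_b(X)_{|\Omega}$ is the set of their restrictions to $\Omega$. For $f\in\mathcal{F}C^1_b(X)$, $\nabla_H f(x)$ is the unique $y\in H$ with $\langle y,h\rangle_H=f'(x)h$ for all $h\in H$. Sobolev space: the operator $\nabla_H:\mathcal{F}C^1_b(X)_{|\Omega}\to L^2(\Omega,\gamma;H)$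 is closable in $L^2(\Omega,\gamma)$; its closure is still denoted $\nabla_H$ and the domain of the closure is $W^{1,2}(\Omega,\gamma)$, with norm $\|f\|^2=\int_\Omega f^2d\gamma+\int_\Omega|\nabla_Hf|_H^2d\gamma$. Ornstein–Uhlenbeck operator: $D(L^\Omega)$ is the set of $u\in W^{1,2}(\Omega,\gamma)$ for which there is $f\in L^2(\Omega,\gamma)$ with $\int_\Omega\langle\nabla_Hu,\nabla_Hv\rangle_Hd\gamma=-\int_\Omega fv\,d\gamma$ for all $v\in W^{1,2}(\Omega,\gamma)$, and $L^\Omega u=f$. $L^\Omega$ is self-adjoint and dissipative in $L^2(\Omega,\gamma)$, and $(T^\Omega(t))_{t\ge0}$ denotes the analytic contraction semigroup it generates. *)

(* Defs.v *)
From HB Require Import structures.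
From mathcomp Require Import all_boot all_order all_algebra.
From mathcomp Require Import all_classical all_reals all_analysis.
Set Implicit Arguments.
Unset Strict Implicit.
Unset Printing Implicit Defensive.
Import Order.TTheory GRing.Theory Num.Theory.
Import numFieldNormedType.Exports.
Local Open Scope classical_set_scope.
Local Open Scope ring_scope.

Notation borel X := (g_sigma_algebraType (@open X)).

Lemma open_borel (X : ptopologicalType) (A : set X) :
  open A -> measurable (A : set (borel X)).
Proof. exact: sub_sigma_algebra. Qed.

Definition separable_space (T : topologicalType) : Prop :=
  exists2 D : set T, countable D & dense D.

Definition infinite_dimensional (R : realType) (X : lmodType R) : Prop :=
  ~ exists (n : nat) (e : 'I_n -> X),
      forall x, exists c : 'I_n -> R, x = \sum_(i < n) c i *: e i.

Definition dual (R : realType) (X : normedModType R) : set (X -> R) :=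
  [set l : X -> R | scalar l /\ continuous l].

Arguments dual {R} X.

Section L2.
Context d (T : measurableType d) (R : realType).
Variable mu : {measure set T -> \bar R}.

(* Elements of L^2 are handled through representatives: everything below that
   takes an element of L^2 is invariant under a.e. equality. *)
Definition L2 : set (T -> R) := [set f | f \in Lfun mu 2%:E].

Definition L2norm (f : T -> R) : \bar R := 'N[mu]_(2%:E)[EFin \o f].

(* [A u g] reads "u is in the domain of A and A u = g". *)
Record C0_contraction_semigroup_generated_by
    (A : (T -> R) -> (T -> R) -> Prop) (S : R -> (T -> R) -> (T -> R)) : Prop :=
  C0ContractionSemigroup {
    sg_L2 : forall t f, 0 <= t -> L2 f -> L2 (S t f) ;
    sg_ae : forall t f g, 0 <= t -> L2 f -> L2 g ->
      f = g %[ae mu] -> S t f = S t g %[ae mu] ;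
    sg_linear : forall t a f g, 0 <= t -> L2 f -> L2 g ->
      S t (fun x => a * f x + g x) = (fun x => a * S t f x + S t g x) %[ae mu] ;
    sg_contraction : forall t f, 0 <= t -> L2 f ->
      (L2norm (S t f) <= L2norm f)%E ;
    sg_0 : forall f, L2 f -> S 0 f = f %[ae mu] ;
    sg_D : forall s t f, 0 <= s -> 0 <= t -> L2 f ->
      S (s + t) f = S s (S t f) %[ae mu] ;
    sg_continuous : forall f, L2 f ->
      L2norm (fun x => S t f x - f x) @[t --> 0^'+] --> 0%E ;
    sg_generator : forall u g, L2 u -> L2 g ->
      (A u g <->
       L2norm (fun x => t^-1 * (S t u x - u x) - g x) @[t --> 0^'+] --> 0%E)
  }.

End L2.

Section CameronMartin.
Context (R : realType) (X : completeNormedModType R).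
Variable gamma : probability (borel X) R.

(* The library's [normal_prob m s] is not a Dirac mass for [s = 0]. *)
Definition gaussian_law (m s : R) : set R -> \bar R :=
  if s == 0 then \d_m else normal_prob m s.

Definition gaussian_measure : Prop :=
  forall l, dual X l -> exists m s : R, forall A : set R, measurable A ->
    gamma (l @^-1` A) = gaussian_law m s A.

Definition centered_measure : Prop :=
  forall l, dual X l -> \int[gamma]_x l x = 0.

Definition nondegenerate_measure : Prop :=
  forall l, dual X l -> (exists x, l x != 0) ->
    (0 < \int[gamma]_x (l x ^+ 2)%:E)%E.

(* X^*_gamma *)
Definition dual_closure : set (X -> R) :=
  [set f : X -> R | L2 gamma f /\ forall e : R, 0 < e ->
     exists2 l, dual X l & (L2norm gamma (fun x => f x - l x)%R < e%:E)%E].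

(* h = R_gamma f *)
Definition is_Rgamma (f : X -> R) (h : X) : Prop :=
  forall g, dual X g -> g h = \int[gamma]_x (f x * g x).

Definition cameron_martin : set X :=
  [set h | exists2 f, dual_closure f & is_Rgamma f h].

Definition hat (h : X) : X -> R :=
  xget (cst 0) [set f | dual_closure f /\ is_Rgamma f h].

Definition dotH (h k : X) : R := \int[gamma]_x (hat h x * hat k x).

Definition normH (h : X) : R := Num.sqrt (dotH h h).

Definition H_simple (s : X -> X) : Prop :=
  exists (m : nat) (A : 'I_m -> set (borel X)) (h : 'I_m -> X),
    [/\ forall i, measurable (A i), forall i, cameron_martin (h i) &
        s = fun x => \sum_(i < m) (\1_(A i) x : R) *: h i].

Definition H_strongly_measurable (F : X -> X) : Prop :=
  exists2 s : nat -> X -> X, forall n, H_simple (s n) &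
    forall x, normH (s n x - F x) @[n --> \oo] --> 0.

Definition L2H (mu : {measure set (borel X) -> \bar R}) : set (X -> X) :=
  [set F | [/\ forall x, cameron_martin (F x), H_strongly_measurable F &
               (\int[mu]_x (normH (F x) ^+ 2)%:E < +oo)%E]].

(* Since R^n is finite-dimensional, continuity of the differential is continuity
   of its value at each vector. *)
Definition C1b (n : nat) (phi : 'rV[R]_n -> R) : Prop :=
  [/\ forall v, differentiable phi v,
      exists M : R, forall v, `|phi v| <= M,
      forall w, continuous (fun v => 'd phi v w) &
      exists M : R, forall v w, `|'d phi v w| <= M * `|w|].

Definition FC1b : set (X -> R) :=
  [set f | exists (n : nat) (phi : 'rV[R]_n -> R) (l : 'I_n -> X -> R),
     [/\ C1b phi, forall i, dual X (l i) &
         forall x, f x = phi (\row_i l i x)]].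

(* y = nabla_H f(x) *)
Definition is_gradH (f : X -> R) (x y : X) : Prop :=
  cameron_martin y /\ forall h, cameron_martin h -> dotH y h = 'd f x h.

Section Omega.
Variables (Om : set X) (oOm : open Om).

(* The restriction of gamma to Om, as a measure on X: L^2(Om, gamma) is L^2 of
   this measure, the values outside Om being irrelevant up to a.e. equality. *)
Definition gamma_on := mrestr gamma (open_borel oOm).
HB.instance Definition _ := Measure.on gamma_on.

(* The graph of nabla_H : FC^1_b(X)|Om -> L^2(Om, gamma; H); that G belongs to
   L^2 is automatic for cylindrical f. *)
Definition cyl_grad (f : X -> R) (G : X -> X) : Prop :=
  [/\ FC1b f, L2H gamma_on G & forall x, Om x -> is_gradH f x (G x)].

(* The closure of this graph: u is in W^{1,2}(Om, gamma) and nabla_H u = F. *)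
Definition sobolev_grad (u : X -> R) (F : X -> X) : Prop :=
  [/\ L2 gamma_on u, L2H gamma_on F &
    exists (f : nat -> X -> R) (G : nat -> X -> X),
      [/\ forall n, cyl_grad (f n) (G n),
          L2norm gamma_on (fun x => f n x - u x) @[n --> \oo] --> 0%E &
          (\int[gamma_on]_x (normH (G n x - F x) ^+ 2)%:E)%E
            @[n --> \oo] --> 0%E]].

(* u is in D(L^Om) and L^Om u = f. *)
Definition ou_operator (u f : X -> R) : Prop :=
  L2 gamma_on f /\ exists2 F, sobolev_grad u F &
    forall v G, sobolev_grad v G ->
      \int[gamma_on]_x dotH (F x) (G x) = - \int[gamma_on]_x (f x * v x).

End Omega.
End CameronMartin.

(* Main.v *)
Require Import Defs.
From HB Require Import structures.
From mathcomp Require Import all_boot all_order all_algebra.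
From mathcomp Require Import all_classical all_reals all_analysis.
From mathcomp Require Import measurable_realfun ring lra.
Set Implicit Arguments.
Unset Strict Implicit.
Unset Printing Implicit Defensive.
Import Order.TTheory GRing.Theory Num.Theory.
Import numFieldNormedType.Exports.
Local Open Scope classical_set_scope.
Local Open Scope ring_scope.

(** The proof is the Beurling-Deny argument, run on the semigroup itself rather
    than on its resolvent. By linearity it suffices to show, for a constant
    [c >= 0], that [phi <= c] implies [T t phi <= c]: the case [c = 1] for [phi]
    and the case [c = 0] for [- phi] give both bounds.

    Fix a convex function [penalty] of class C^2 that vanishes exactly on the
    nonpositive numbers and has bounded second derivative, and let [W u] be the
    integral of [penalty (u - c)]. Then [W u = 0] says that [u <= c] almost
    everywhere, so it is enough that [W] does not increase along the semigroup.

    - Dissipativity ([ou_dissipative]). If [L u = g], then the integral of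
      [g * penalty' (u - c)] is nonpositive. Formally it is minus the integral of
      [penalty'' (u - c) * |grad u|^2]. The weak equation is only tested with
      the cylindrical functions [penalty' (f_n - c)], where [f_n] approximates
      [u] in the Sobolev norm; their gradient is given by the finite-dimensional
      chain rule, and the polarization bound
      [<F, G_n> >= - |F - G_n|^2 / 4] recovers the sign in the limit.

    - Lyapunov principle ([lyapunov_semigroup]). A convex function whose
      derivative is nonpositive along the generator decreases along the
      semigroup. On the domain of the generator this is an Euler-type estimate
      on a fine subdivision of the time interval. It extends to every initial
      value since the domain is dense ([generator_dense]): it contains the time
      averages of orbits, which are limits of Riemann sums and exist because
      L^2 is complete ([L2_complete]).

    The Gaussian hypothesis enters through the second moments of continuous
    linear functionals ([dual_L2]), which make the inner product of the
    Cameron-Martin space bilinear. *)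

(** * Square-integrable functions *)

Section SquareIntegrable.
Context d (T : measurableType d) (R : realType).
Variable mu : {measure set T -> \bar R}.
Implicit Types f g h : T -> R.
Local Notation L2 := (L2 mu).

(** The inner product and seminorm of L^2 as real numbers; on functions outside
    L^2 their values carry no meaning. *)
Definition ip f g := \int[mu]_x (f x * g x).
Definition nrm f := Num.sqrt (ip f f).

Lemma L2_measurable f : L2 f -> measurable_fun setT f.
Proof. by move=> /andP[]; rewrite inE. Qed.

Lemma L2_sqr_integrable f : L2 f -> mu.-integrable setT (EFin \o (fun x => f x ^+ 2)).
Proof. exact: Lfun2_integrable_sqr. Qed.

Lemma L2_mul_integrable f g : L2 f -> L2 g ->
  mu.-integrable setT (EFin \o (fun x => f x * g x)).
Proof. by move=> Lf Lg; apply/Lfun1_integrable; exact: Lfun2_mul_Lfun1. Qed.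

Lemma Lnorm2E f : L2norm mu f = ((\int[mu]_x (f x ^+ 2)%:E) `^ 2^-1)%E.
Proof.
rewrite /L2norm unlock /=; congr (_ `^ _)%E; apply: eq_integral => x _.
by rewrite /= powR_mulrn// real_normK ?num_real.
Qed.

Lemma L2_bounded_sqr f : measurable_fun setT f ->
  (\int[mu]_x (f x ^+ 2)%:E < +oo)%E -> L2 f.
Proof.
move=> mf foo; apply/andP; split; first by rewrite inE.
rewrite inE /= /finite_norm -/(L2norm mu f) Lnorm2E.
by apply: poweR_lty.
Qed.

Lemma L2_dominated f g : measurable_fun setT f -> L2 g ->
  (forall x, f x ^+ 2 <= g x ^+ 2) -> L2 f.
Proof.
move=> mf Lg fg; apply: L2_bounded_sqr => //.
have /integrableP[mg2 g2] := L2_sqr_integrable Lg.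
apply: le_lt_trans g2; apply: ge0_le_integral => //.
- by move=> x _; rewrite lee_fin sqr_ge0.
- by apply/measurable_EFinP; exact: measurable_funX.
- exact: measurableT_comp.
- by move=> x _ /=; rewrite lee_fin (le_trans (fg x)) ?ler_norm.
Qed.

Lemma L2_lin a f g : L2 f -> L2 g -> L2 (fun x => a * f x + g x).
Proof. by move=> Lf Lg; apply: (Lfun_submod_closed mu (lee1n 2)).2. Qed.

Lemma L2_cst0 : L2 (fun=> 0).
Proof. exact: (Lfun_submod_closed mu (lee1n 2)).1. Qed.

Lemma L2Z a f : L2 f -> L2 (fun x => a * f x).
Proof.
move=> Lf; have := L2_lin a Lf L2_cst0.
by congr L2; apply/funext => x; rewrite addr0.
Qed.

Lemma L2B f g : L2 f -> L2 g -> L2 (fun x => f x - g x).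
Proof.
move=> Lf Lg; have := L2_lin (-1) Lg Lf.
by congr L2; apply/funext => x; rewrite mulN1r addrC.
Qed.

Lemma ipC f g : ip f g = ip g f.
Proof. by apply: eq_Rintegral => x _; rewrite mulrC. Qed.

Lemma integrable_EFinZl a f : mu.-integrable setT (EFin \o f) ->
  mu.-integrable setT (EFin \o (fun x => a * f x)).
Proof.
move=> /(@integrableZl _ _ _ mu _ measurableT a).
by apply: eq_integrable => // x _; rewrite /= EFinM.
Qed.

Lemma ip_lin a f g h : L2 f -> L2 g -> L2 h ->
  ip (fun x => a * f x + g x) h = a * ip f h + ip g h.
Proof.
move=> Lf Lg Lh; rewrite /ip -RintegralZl//; last exact: L2_mul_integrable.
rewrite -RintegralD//; [|apply: integrable_EFinZl|exact: L2_mul_integrable] => //.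
  by apply: eq_Rintegral => x _; rewrite mulrDl mulrA.
exact: L2_mul_integrable.
Qed.

Lemma ip_linr a f g h : L2 f -> L2 g -> L2 h ->
  ip h (fun x => a * f x + g x) = a * ip h f + ip h g.
Proof. by move=> ? ? ?; rewrite ipC ip_lin// !(ipC h). Qed.

Lemma ipB f g h : L2 f -> L2 g -> L2 h ->
  ip (fun x => f x - g x) h = ip f h - ip g h.
Proof.
move=> Lf Lg Lh; rewrite (_ : (fun _ => _) = (fun x => -1 * g x + f x)).
  by rewrite ip_lin// mulN1r addrC.
by apply/funext => x; rewrite mulN1r addrC.
Qed.

Lemma ipBr f g h : L2 f -> L2 g -> L2 h ->
  ip h (fun x => f x - g x) = ip h f - ip h g.
Proof. by move=> ? ? ?; rewrite ipC ipB// !(ipC h). Qed.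

Lemma ip_ge0 f : 0 <= ip f f.
Proof. by apply: Rintegral_ge0 => x _; rewrite -expr2 sqr_ge0. Qed.

Lemma nrm_ge0 f : 0 <= nrm f.
Proof. exact: sqrtr_ge0. Qed.

Lemma nrm_sqr f : nrm f ^+ 2 = ip f f.
Proof. by rewrite sqr_sqrtr ?ip_ge0. Qed.

Lemma integral_sqr f : L2 f -> (\int[mu]_x (f x ^+ 2)%:E = (nrm f ^+ 2)%:E)%E.
Proof.
move=> Lf; rewrite nrm_sqr /ip /Rintegral fineK.
  by apply: eq_integral => x _; rewrite expr2.
have := L2_mul_integrable Lf Lf; exact: integrable_fin_num.
Qed.

Lemma L2normE f : L2 f -> L2norm mu f = (nrm f)%:E.
Proof.
move=> Lf; rewrite Lnorm2E integral_sqr// poweR_EFin powR12_sqrt ?sqr_ge0//.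
by rewrite sqrtr_sqr ger0_norm ?nrm_ge0.
Qed.

Lemma ae_eq_ip f f' g g' : f = f' %[ae mu] -> g = g' %[ae mu] ->
  L2 f -> L2 f' -> L2 g -> L2 g' -> ip f g = ip f' g'.
Proof.
move=> ff gg Lf Lf' Lg Lg'; rewrite /ip /Rintegral; congr fine.
apply: ae_eq_integral => //.
- by have /integrableP[] := L2_mul_integrable Lf Lg.
- by have /integrableP[] := L2_mul_integrable Lf' Lg'.
by apply: filterS2 ff gg => x fx gx _; rewrite /= fx// gx.
Qed.

Lemma nrm_eq0 f : L2 f -> nrm f = 0 -> f = (fun=> 0) %[ae mu].
Proof.
move=> Lf f0; have mf := L2_measurable Lf.
have : EFin \o f = \0%E %[ae mu].
  apply: (@Lnorm_eq0_eq0 _ _ _ mu _ 2%:E) => //; first exact/measurable_EFinP.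
  by rewrite -/(L2norm mu f) L2normE// f0.
by apply: filterS => x /= /(_ I) [].
Qed.

Lemma ae_eq0_nrm f : L2 f -> f = (fun=> 0) %[ae mu] -> nrm f = 0.
Proof.
move=> Lf f0; rewrite /nrm (ae_eq_ip f0 f0)//; try exact: L2_cst0.
rewrite /ip (_ : Rintegral _ _ _ = 0) ?sqrtr0//.
by under eq_Rintegral do rewrite mulr0; rewrite Rintegral_cst// mul0r.
Qed.

Lemma nrmD_sqr f g : L2 f -> L2 g ->
  nrm (fun x => f x + g x) ^+ 2 = nrm f ^+ 2 + 2 * ip f g + nrm g ^+ 2.
Proof.
move=> Lf Lg.
rewrite !nrm_sqr (_ : (fun _ => _) = (fun x => 1 * f x + g x)); last first.
  by apply/funext => x; rewrite mul1r.
by rewrite ip_lin ?ip_linr ?ip_lin ?(ipC g f) ?ip_linr//; [lra|exact: L2_lin].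
Qed.

Lemma nrmZ a f : L2 f -> nrm (fun x => a * f x) = `|a| * nrm f.
Proof.
move=> Lf; rewrite /nrm (_ : ip _ _ = a ^+ 2 * ip f f).
  by rewrite sqrtrM ?sqr_ge0// sqrtr_sqr.
rewrite /ip -RintegralZl//; last exact: L2_mul_integrable.
by apply: eq_Rintegral => x _; ring.
Qed.

(** Cauchy-Schwarz, as the case [p = q = 2] of Hoelder's inequality. *)
Lemma ip_le_nrm f g : L2 f -> L2 g -> `|ip f g| <= nrm f * nrm g.
Proof.
move=> Lf Lg.
have /= := @hoelder _ _ _ mu f g 2 2 (L2_measurable Lf) (L2_measurable Lg).
rewrite -/(L2norm mu f) -/(L2norm mu g) !L2normE// Lnorm1.
move=> H; rewrite -lee_fin EFinM; apply: (le_trans _ (H _ _ _)) => //; last first.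
  by rewrite -[X in X = 1%R]/(2^-1 + 2^-1); lra.
have ifg := L2_mul_integrable Lf Lg.
rewrite EFin_normr_Rintegral//.
apply: le_abse_integral => //.
by have /integrableP[] := ifg.
Qed.

Lemma nrmD f g : L2 f -> L2 g -> nrm (fun x => f x + g x) <= nrm f + nrm g.
Proof.
move=> Lf Lg; rewrite -(@ler_pXn2r _ 2)// ?nnegrE ?addr_ge0 ?nrm_ge0//.
rewrite nrmD_sqr//; have := ip_le_nrm Lf Lg; move/(le_trans (ler_norm _)).
by move=> H; nra.
Qed.

Lemma L2_cst (c : R) : (mu setT < +oo)%E -> L2 (fun=> c).
Proof.
move=> muoo; apply: L2_bounded_sqr => //.
by rewrite integral_cst// lte_mul_pinfty// ?lee_fin ?sqr_ge0.
Qed.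

End SquareIntegrable.

Lemma nrm_dominated d (T : measurableType d) (R : realType)
    (mu : {measure set T -> \bar R}) (f g : T -> R) : L2 mu f -> L2 mu g ->
  (forall x, `|f x| <= `|g x|) -> nrm mu f <= nrm mu g.
Proof.
move=> Lf Lg fg; rewrite ler_wsqrtr// /ip; apply: le_Rintegral => //.
- exact: L2_mul_integrable.
- exact: L2_mul_integrable.
move=> x _; rewrite -!expr2 -real_normK ?num_real// -[leRHS]real_normK ?num_real//.
by rewrite ler_pXn2r// nnegrE.
Qed.

Section Completeness.
Context d (T : measurableType d) (R : realType).
Variable mu : {measure set T -> \bar R}.
Local Notation L2 := (L2 mu).
Local Notation nrm := (nrm mu).

Lemma cvg_EFin_comp (u : R^nat) (l : R) :
  u @ \oo --> l -> (fun n => (u n)%:E) @ \oo --> l%:E.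
Proof. by move=> ul; apply/fine_cvgP; split => //; exact: nearW. Qed.

Lemma limn_einf_le_near (u : (\bar R)^nat) (l : \bar R) (N : nat) :
  (forall n, (N <= n)%N -> (u n <= l)%E) -> (limn_einf u <= l)%E.
Proof.
move=> ul; rewrite limn_einf_lim; apply: lime_le; first exact: is_cvg_einfs.
near=> n; apply: le_trans (ul n _); last by near: n; exists N.
by apply: ereal_inf_lbound; exists n => //=.
Unshelve. all: by end_near. Qed.

(** The weights [4 ^+ k] force the increments to be dominated by a geometric
    sequence of ratio 1/2. *)
Lemma fast_cauchy_cvg (g : R^nat) (M : R) :
  (forall k, 4 ^+ k * (g k.+1 - g k) ^+ 2 <= M) -> cvgn g.
Proof.
move=> gM; have M0 : 0 <= M.
  by apply: le_trans (gM 0%N); rewrite mulr_ge0// sqr_ge0.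
have dg k : `|g k.+1 - g k| <= geometric (Num.sqrt M) 2^-1 k.
  rewrite /= -(@ler_pXn2r _ 2)// ?nnegrE ?mulr_ge0 ?sqrtr_ge0 ?exprn_ge0//.
  rewrite exprMn sqr_sqrtr// real_normK ?num_real//.
  have -> : ((2^-1 : R) ^+ k) ^+ 2 = (4 ^+ k)^-1.
    by rewrite -exprM mulnC exprM exprVn -natrX exprVn.
  by rewrite ler_pdivlMr ?exprn_gt0// mulrC.
have /normed_cvg : cvgn [normed series (telescope g)].
  apply: (@series_le_cvg _ _ (geometric (Num.sqrt M) 2^-1)) => //=.
  by apply: is_cvg_geometric_series; rewrite ger0_norm ?invr_ge0// invf_lt1// ltr1n.
rewrite telescopeK => /cvg_ex[l gl]; apply: (cvgP (l + g 0%N)).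
have E : [sequence g n - g 0%N]_n \+ cst (g 0%N) = g.
  by apply/funext => n; rewrite /= subrK.
by rewrite -{1}E; exact: cvgD gl (cvg_cst _).
Qed.

Lemma geometric_sum_le (n : nat) : \sum_(0 <= k < n) (4^-1 : R) ^+ k <= 2.
Proof.
suff : \sum_(0 <= k < n) (4^-1 : R) ^+ k <= 2 - 2 * 4^-1 ^+ n.
  by move/le_trans; apply; rewrite gerBl mulr_ge0.
elim: n => [|n IH]; first by rewrite big_nil expr0; lra.
rewrite big_nat_recr//= exprS.
have : 0 <= (4^-1 : R) ^+ n by rewrite exprn_ge0.
by move: (4^-1 ^+ n : R) IH => z; lra.
Qed.

(** The weighted sum of the squared increments has finite integral, hence is
    finite almost everywhere, and then bounds the increments geometrically. *)
Lemma fast_cauchy_ae_cvg (g : nat -> T -> R) :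
  (forall k, L2 (g k)) ->
  (forall k, nrm (fun x => g k.+1 x - g k x) <= 4^-1 ^+ k) ->
  {ae mu, forall x, cvgn (g ^~ x)}.
Proof.
move=> Lg dg.
pose s k x := (4 ^+ k * (g k.+1 x - g k x) ^+ 2)%:E.
have s0 k x : (0 <= s k x)%E.
  by rewrite lee_fin; apply: mulr_ge0; [exact: exprn_ge0 | exact: sqr_ge0].
have Ld k : L2 (fun x => g k.+1 x - g k x) by exact: L2B.
have ms k : measurable_fun setT (s k).
  apply/measurable_EFinP/measurable_funM => //.
  by apply: measurable_funX; exact: L2_measurable (Ld k).
have intS : (\int[mu]_x (\sum_(0 <= k <oo) s k x) < +oo)%E.
  rewrite integral_nneseries//; apply: (@le_lt_trans _ _ 2%:E); last exact: ltry.
  apply: lime_le.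
    by apply: is_cvg_nneseries => k _ _; apply: integral_ge0 => x _; exact: s0.
  near=> n; apply: (@le_trans _ _ (\sum_(0 <= k < n) (4^-1 : R) ^+ k)%:E).
    rewrite -sumEFin; apply: lee_sum => k _.
    rewrite /s; under eq_integral do rewrite EFinM.
    rewrite ge0_integralZl//; last 2 first.
    - apply/measurable_EFinP/measurable_funX; exact: L2_measurable (Ld k).
    - by move=> x _; rewrite lee_fin sqr_ge0.
    rewrite integral_sqr// -EFinM lee_fin.
    have dk := dg k; have n0 := nrm_ge0 mu (fun x => g k.+1 x - g k x).
    move: (nrm _) dk n0 => z zk z0.
    apply: (@le_trans _ _ (4 ^+ k * ((4^-1 ^+ k) ^+ 2))).
      by rewrite ler_wpM2l// ?exprn_ge0// ler_pXn2r// nnegrE// exprn_ge0.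
    by rewrite expr2 mulrA -exprMn divff ?expr1n ?mul1r// pnatr_eq0.
  by rewrite lee_fin geometric_sum_le.
have iS : mu.-integrable setT (fun x => \sum_(0 <= k <oo) s k x)%E.
  apply/integrableP; split; first exact: ge0_emeasurable_sum.
  rewrite (le_lt_trans _ intS)//; rewrite le_eqVlt; apply/orP; left; apply/eqP.
  by apply: eq_integral => x _; rewrite gee0_abs// nneseries_ge0.
apply: filterS (integrable_ae measurableT iS) => x /(_ I) fS.
apply: (@fast_cauchy_cvg _ (fine (\sum_(0 <= k <oo) s k x)%E)) => k.
rewrite -lee_fin fineK// -[leLHS]/(s k x).
have := @nneseries_lim_ge _ (s ^~ x) xpredT 0 k.+1 (fun n _ _ => s0 n x).
apply: le_trans; rewrite big_nat_recr//= leeDr//.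
exact: sume_ge0.
Unshelve. all: by end_near. Qed.

(** Riesz-Fischer: a rapidly Cauchy subsequence has an almost everywhere limit,
    which Fatou's lemma identifies as the limit in norm. The limit superior
    is a measurable choice of that limit. *)
Lemma L2_complete (f : nat -> T -> R) :
  (forall n, L2 (f n)) ->
  (forall e, 0 < e -> exists N, forall n m, (N <= n)%N -> (N <= m)%N ->
     nrm (fun x => f n x - f m x) <= e) ->
  exists2 g, L2 g & forall e, 0 < e -> exists N, forall n, (N <= n)%N ->
     nrm (fun x => f n x - g x) <= e.
Proof.
move=> Lf cf.
have /choice[N NP] : forall k, exists N, forall n m, (N <= n)%N -> (N <= m)%N ->
    nrm (fun x => f n x - f m x) <= 4^-1 ^+ k.
  by move=> k; apply: cf; rewrite exprn_gt0.
(* the summand [k] makes the subsequence unbounded *)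
pose nk k := (k + \sum_(i < k.+1) N i)%N.
have nkN k : (N k <= nk k)%N by rewrite /nk big_ord_recr/= addnA leq_addl.
have nkS k : (nk k <= nk k.+1)%N.
  by rewrite /nk [in leqRHS]big_ord_recr/= leq_add// leq_addr.
have nk_ge k : (k <= nk k)%N by rewrite leq_addr.
pose g k := f (nk k).
have Lg k : L2 (g k) by exact: Lf.
have gc : {ae mu, forall x, cvgn (g ^~ x)}.
  apply: fast_cauchy_ae_cvg => // k; apply: NP => //.
  exact: leq_trans (nkS k).
pose h x := fine (limn_esup (fun k => (g k x)%:E)).
have mh : measurable_fun setT h.
  apply: measurableT_comp; first exact: fine_measurable.
  by apply: measurable_fun_limn_esup => k; apply/measurable_EFinP/L2_measurable.
have gh : {ae mu, forall x, g ^~ x @ \oo --> h x}.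
  apply: filterS gc => x /cvg_ex[l gl].
  rewrite /h (_ : limn_esup _ = l%:E)//=.
  by have [_ ->] := cvg_limn_einf_sup (cvg_EFin_comp gl).
have fatou_h e n K : (forall m, (K <= m)%N -> nrm (fun x => f n x - g m x) <= e) ->
    (\int[mu]_x ((f n x - h x) ^+ 2)%:E <= (e ^+ 2)%:E)%E.
  move=> ne; pose u m x := ((f n x - g m x) ^+ 2)%:E.
  have mu_ m : measurable_fun setT (u m).
    apply/measurable_EFinP/measurable_funX/measurable_funB; exact: L2_measurable.
  apply: (@le_trans _ _ (\int[mu]_x limn_einf (u ^~ x))%E).
    rewrite le_eqVlt; apply/orP; left; apply/eqP; apply: ae_eq_integral => //.
    - by apply/measurable_EFinP/measurable_funX/measurable_funB => //; exact: L2_measurable.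
    - apply: measurableT_comp => //; apply: measurable_fun_limn_esup => m.
      exact: measurableT_comp.
    apply: filterS gh => x gx _.
    suff /cvg_limn_einf_sup[-> _] : u ^~ x @ \oo --> ((f n x - h x) ^+ 2)%:E by [].
    apply: cvg_EFin_comp; apply: cvgM; apply: cvgB => //; exact: cvg_cst.
  apply: le_trans (fatou _ measurableT mu_ _) _.
    by move=> m x _; rewrite lee_fin sqr_ge0.
  apply: (@limn_einf_le_near _ _ K) => m Km.
  rewrite integral_sqr; last exact: L2B.
  by rewrite lee_fin ler_pXn2r// ?nnegrE ?nrm_ge0// (le_trans _ (ne m Km))// nrm_ge0.
have Lfh n e K : (forall m, (K <= m)%N -> nrm (fun x => f n x - g m x) <= e) ->
    L2 (fun x => f n x - h x).
  move=> ne; apply: L2_bounded_sqr; last exact: le_lt_trans (fatou_h e n K ne) (ltry _).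
  by apply: measurable_funB => //; exact: L2_measurable.
have near_h e : 0 < e -> exists M, forall n, (M <= n)%N ->
    L2 (fun x => f n x - h x) /\ nrm (fun x => f n x - h x) <= e.
  move=> e0; have [M MP] := cf e e0; exists M => n Mn.
  have ne m : (M <= m)%N -> nrm (fun x => f n x - g m x) <= e.
    by move=> Mm; apply: MP => //; exact: leq_trans (nk_ge m).
  have Lnh := Lfh _ _ _ ne; split => //.
  rewrite -(@ler_pXn2r _ 2)// ?nnegrE ?nrm_ge0 ?(ltW e0)//.
  by rewrite -lee_fin -integral_sqr//; exact: fatou_h ne.
exists h; last first.
  by move=> e /near_h[M Mh]; exists M => n /Mh[].
have [M /(_ M (leqnn _))[LMh _]] := near_h 1 ltr01.
have := L2B (Lf M) LMh; congr L2; apply/funext => x; lra.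
Qed.
End Completeness.

(** * Contraction semigroups in a seminormed space *)

Lemma sumr_nat_mul (V : nmodType) (n m : nat) (F : nat -> V) :
  \sum_(0 <= i < n * m) F i =
  \sum_(0 <= k < n) \sum_(0 <= l < m) F (k * m + l)%N.
Proof.
elim: n => [|n IH]; first by rewrite mul0n !big_nil.
rewrite big_nat_recr//= -IH mulSnr (big_cat_nat _ (n := n * m)%N)//= ?leq_addr//.
congr (_ + _); rewrite -{1}[(n * m)%N]add0n big_addn addKn.
by apply: eq_bigr => l _; rewrite addnC.
Qed.

Lemma sumr_nat_shift (V : zmodType) (n j : nat) (F : nat -> V) :
  \sum_(0 <= i < n) F (i + j)%N - \sum_(0 <= i < n) F i =
  \sum_(0 <= i < j) (F (i + n)%N - F i).
Proof.
have sh a b : \sum_(0 <= i < b) F (i + a)%N = \sum_(a <= i < b + a) F i.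
  by rewrite -{2}[a]add0n big_addn addnK.
have E a b : \sum_(0 <= i < a) F i + \sum_(a <= i < b + a) F i = \sum_(0 <= i < a + b) F i.
  by rewrite [(b + a)%N]addnC [RHS](big_cat_nat _ (n := a))//= leq_addr.
rewrite sumrB !sh; apply/eqP; rewrite subr_eq addrAC eq_sym subr_eq; apply/eqP.
by rewrite addrC E [RHS]addrC E addnC.
Qed.

Lemma div_nat_lt_near (R : realType) (a r : R) : 0 < r ->
  exists M, forall n, (M <= n)%N -> (0 < n)%N /\ a / n%:R < r.
Proof.
move=> r0; exists (Num.truncn (a / r)).+1 => n Mn.
have n0 : (0 < n)%N by exact: leq_ltn_trans Mn.
split => //; rewrite ltr_pdivrMr ?ltr0n// mulrC -ltr_pdivrMr//.
apply: lt_le_trans (truncnS_gt _) _; by rewrite ler_nat.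
Qed.

Section ContractionSemigroup.
Context (R : realType) (V : lmodType R).

(** A seminorm rather than a norm, since the semigroup acts on representatives
    of classes of almost everywhere equal functions. *)
Record complete_seminorm (N : V -> R) := CompleteSeminorm {
  csn_Z : forall a x, N (a *: x) = `|a| * N x ;
  csn_D : forall x y, N (x + y) <= N x + N y ;
  csn_complete : forall f : nat -> V,
    (forall e, 0 < e -> exists M, forall n m, (M <= n)%N -> (M <= m)%N ->
      N (f n - f m) <= e) ->
    exists v, forall e, 0 < e -> exists M, forall n, (M <= n)%N ->
      N (f n - v) <= e
}.

Record contraction_semigroup (N : V -> R) (S : R -> V -> V) :=
  ContractionSemigroup {
  cs_lin : forall t a x y, 0 <= t ->
    N (S t (a *: x + y) - (a *: S t x + S t y)) = 0 ;
  cs_contr : forall t x, 0 <= t -> N (S t x) <= N x ;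
  cs_0 : forall x, N (S 0 x - x) = 0 ;
  cs_semigroup : forall s t x, 0 <= s -> 0 <= t ->
    N (S (s + t) x - S s (S t x)) = 0 ;
  cs_cont : forall x e, 0 < e -> exists2 r, 0 < r &
    forall h, 0 < h -> h < r -> N (S h x - x) <= e
}.

(** [g] is the derivative at time 0 of the orbit of [u]. *)
Definition is_generator (N : V -> R) (S : R -> V -> V) (u g : V) :=
  forall e, 0 < e -> exists2 r, 0 < r & forall h, 0 < h -> h < r ->
    N (S h u - u - h *: g) <= e * h.

Context (N : V -> R) (S : R -> V -> V).
Hypotheses (cN : complete_seminorm N) (cS : contraction_semigroup N S).

Lemma csn_0 : N 0 = 0.
Proof. by rewrite -(scale0r 0) (csn_Z cN) normr0 mul0r. Qed.
Lemma csn_N x : N (- x) = N x.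
Proof. by rewrite -scaleN1r (csn_Z cN)// normrN1 mul1r. Qed.
Lemma csn_C x y : N (x - y) = N (y - x).
Proof. by rewrite -csn_N opprB. Qed.
Lemma csn_ge0 x : 0 <= N x.
Proof. by have := csn_D cN x (- x); rewrite subrr csn_0 csn_N; lra. Qed.
Lemma csn_triangle y x z : N (x - z) <= N (x - y) + N (y - z).
Proof. by rewrite -[x - z](subrKA y); exact: csn_D cN _ _. Qed.
Lemma csn_sum n (F : nat -> V) e :
  (forall i, (i < n)%N -> N (F i) <= e) -> N (\sum_(0 <= i < n) F i) <= e *+ n.
Proof.
elim: n => [|n IH] Fe; first by rewrite big_nil csn_0.
rewrite big_nat_recr//= (le_trans (csn_D cN _ _))//.
by rewrite mulrSr lerD// ?Fe// IH// => i /ltnW; exact: Fe.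
Qed.

(* Equality in the quotient by the null space of the seminorm. *)
Local Notation eqN x y := (N (x - y) = 0).
Lemma eqN_refl x : eqN x x. Proof. by rewrite subrr csn_0. Qed.
Lemma eqN_sym x y : eqN x y -> eqN y x.
Proof. by rewrite csn_C. Qed.
Lemma eqN_trans y x z : eqN x y -> eqN y z -> eqN x z.
Proof.
move=> xy yz; apply: le_anti; rewrite csn_ge0 andbT.
by rewrite (le_trans (csn_triangle y _ _))// xy yz addr0.
Qed.
Lemma eqND x y x' y' : eqN x x' -> eqN y y' -> eqN (x + y) (x' + y').
Proof.
move=> xx yy; apply: le_anti; rewrite csn_ge0 andbT opprD addrACA.
by rewrite (le_trans (csn_D cN _ _))// xx yy addr0.
Qed.
Lemma eqNZ a x y : eqN x y -> eqN (a *: x) (a *: y).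
Proof. by rewrite -scalerBr (csn_Z cN) => ->; rewrite mulr0. Qed.
Lemma eqNB x y x' y' : eqN x x' -> eqN y y' -> eqN (x - y) (x' - y').
Proof. by move=> xx yy; apply: eqND => //; rewrite -opprD csn_N. Qed.
Lemma eqN_N x y : eqN x y -> N x = N y.
Proof.
move=> xy; have := csn_D cN (x - y) y; have := csn_D cN (y - x) x.
by rewrite !subrK xy (csn_C y) xy; lra.
Qed.

Lemma cs_eqN_lin t a x y : 0 <= t -> eqN (S t (a *: x + y)) (a *: S t x + S t y).
Proof. exact: (cs_lin cS). Qed.

Lemma cs_eqN_B t x y : 0 <= t -> eqN (S t (x - y)) (S t x - S t y).
Proof.
move=> t0; have := cs_eqN_lin (-1) y x t0.
by rewrite !scaleN1r ![- _ + _]addrC.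
Qed.

Lemma cs_lip t x y : 0 <= t -> N (S t x - S t y) <= N (x - y).
Proof. by move=> t0; rewrite -(eqN_N (cs_eqN_B _ _ t0)) (cs_contr cS). Qed.

Lemma cs_eqN_0 t : 0 <= t -> eqN (S t 0) 0.
Proof. by move=> t0; have := cs_eqN_B 0 0 t0; rewrite !subrr. Qed.

Lemma cs_eqN_Z t a x : 0 <= t -> eqN (S t (a *: x)) (a *: S t x).
Proof.
move=> t0; have := cs_eqN_lin a x 0 t0; rewrite addr0 => /eqN_trans; apply.
by rewrite -[X in eqN _ X]addr0; apply: eqND; [exact: eqN_refl|exact: cs_eqN_0].
Qed.

Lemma cs_eqN_sum t n (F : nat -> V) : 0 <= t ->
  eqN (S t (\sum_(0 <= i < n) F i)) (\sum_(0 <= i < n) S t (F i)).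
Proof.
move=> t0; elim: n => [|n IH]; first by rewrite !big_nil; exact: cs_eqN_0.
rewrite !big_nat_recr//= -[X in S t (X + _)]scale1r.
apply: eqN_trans (cs_eqN_lin _ _ _ t0) _; rewrite scale1r.
by apply: eqND => //; exact: eqN_refl.
Qed.

(** The error of the first-order expansion at time [t] is no larger than at time
    0: it is the image of the latter under the contraction [S t]. *)
Lemma is_generator_orbit u g e h t : 0 <= t -> 0 <= h ->
  N (S h u - u - h *: g) <= e * h ->
  N (S (t + h) u - S t u - h *: S t g) <= e * h.
Proof.
move=> t0 h0; apply: le_trans; rewrite [leLHS](@eqN_N _ (S t (S h u - u - h *: g))).
  exact: (cs_contr cS).
apply: eqN_sym; apply: eqN_trans (cs_eqN_B _ _ t0) _; apply: eqNB.
  apply: eqN_trans (cs_eqN_B _ _ t0) _; apply: eqNB; last exact: eqN_refl.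
  by apply: eqN_sym; exact: (cs_semigroup cS).
exact: cs_eqN_Z.
Qed.

Section Orbit.
Variables (phi : V) (eps : R).
Hypothesis eps0 : 0 < eps.

Lemma orbit_step s h : 0 <= s -> 0 <= h ->
  N (S (s + h) phi - S s phi) <= N (S h phi - phi).
Proof.
move=> s0 h0; rewrite -(@eqN_N (S s (S h phi) - S s phi)) ?cs_lip//.
by apply: eqNB; [apply: eqN_sym; exact: (cs_semigroup cS)|exact: eqN_refl].
Qed.

Lemma orbit_cont e : 0 < e -> exists2 r, 0 < r &
  forall s h, 0 <= s -> 0 <= h -> h < r -> N (S (s + h) phi - S s phi) <= e.
Proof.
move=> e0; have [r r0 rP] := cs_cont cS phi e0; exists r => // s h s0 h0 hr.
apply: le_trans (orbit_step s0 h0) _.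
move: h0; rewrite le_eqVlt => /predU1P[<-|h0]; last exact: rP.
by rewrite (cs_0 cS) ltW.
Qed.

(** The mean of the orbit of [phi] over [0, eps], sampled at [n] equidistant
    points. *)
Definition riemann n := n%:R^-1 *: \sum_(0 <= k < n) S (eps * k%:R / n%:R) phi.

Lemma csn_avg n (F : nat -> V) e : 0 <= e ->
  (forall i, (i < n)%N -> N (F i) <= e) ->
  N (n%:R^-1 *: \sum_(0 <= i < n) F i) <= e.
Proof.
move=> e0 Fe; rewrite (csn_Z cN) ger0_norm ?invr_ge0//.
case: n Fe => [|n] Fe; first by rewrite invr0 mul0r.
by rewrite ler_pdivrMl// mulr_natl; exact: csn_sum.
Qed.

Lemma avg_cst n (x : V) : (0 < n)%N -> n%:R^-1 *: \sum_(0 <= i < n) x = x.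
Proof.
move=> n0; rewrite sumr_const_nat subn0 -(scaler_nat n x) scalerA mulVf ?scale1r//.
by rewrite pnatr_eq0 -lt0n.
Qed.

(** Each sample of the coarse mean is compared with the [m] samples of the fine
    mean that follow it within one coarse mesh. *)
Lemma riemann_refine n m e r : (0 < n)%N -> (0 < m)%N -> 0 <= e ->
  eps / n%:R < r ->
  (forall s h, 0 <= s -> 0 <= h -> h < r -> N (S (s + h) phi - S s phi) <= e) ->
  N (riemann (n * m) - riemann n) <= e.
Proof.
move=> n0 m0 e0 nr H.
have n0' : 0 < n%:R :> R by rewrite ltr0n.
have m0' : 0 < m%:R :> R by rewrite ltr0n.
rewrite /riemann sumr_nat_mul natrM.
rewrite (_ : _ - _ = n%:R^-1 *: \sum_(0 <= k < n) (m%:R^-1 *: \sum_(0 <= l < m)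
    (S (eps * k%:R / n%:R + eps * l%:R / (n%:R * m%:R)) phi - S (eps * k%:R / n%:R) phi))).
  apply: csn_avg => // k kn; apply: csn_avg => // l lm; apply: H.
  - by rewrite divr_ge0// mulr_ge0// ltW.
  - by rewrite divr_ge0// ?mulr_ge0// ltW.
  - apply: le_lt_trans nr; rewrite ler_pdivrMr ?mulr_gt0//.
    rewrite mulrA divfK ?gt_eqF// ler_pM2l// ler_nat; exact: ltnW.
rewrite invfM -scalerA -scalerBr; congr (_ *: _).
rewrite scaler_sumr -sumrB; apply: eq_bigr => k _.
rewrite sumrB scalerBr; congr (_ - _).
  congr (_ *: _); apply: eq_bigr => l _; congr (S _ _).
  rewrite natrD natrM; field.
  by rewrite ?gt_eqF.
by rewrite avg_cst.
Qed.

Lemma riemann_cvg : exists v, forall e, 0 < e ->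
  exists M, forall n, (M <= n)%N -> N (riemann n - v) <= e.
Proof.
apply: (csn_complete cN) => e e0.
have e2 : 0 < e / 2 by lra.
have [r r0 H] := orbit_cont e2; have [M MP] := div_nat_lt_near eps r0.
exists M => n m /MP[n0 nr] /MP[m0 mr].
apply: le_trans (csn_triangle (riemann (n * m)) _ _) _.
rewrite csn_C {2}mulnC.
have := riemann_refine n0 m0 (ltW e2) nr H.
by have := riemann_refine m0 n0 (ltW e2) mr H; lra.
Qed.

Lemma riemann_near e r n : 0 <= e -> eps < r -> (0 < n)%N ->
  (forall s h, 0 <= s -> 0 <= h -> h < r -> N (S (s + h) phi - S s phi) <= e) ->
  N (riemann n - phi) <= e.
Proof.
move=> e0 er n0 H.
have n0' : 0 < n%:R :> R by rewrite ltr0n.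
rewrite /riemann (_ : _ - _ = n%:R^-1 *: \sum_(0 <= k < n) (S (eps * k%:R / n%:R) phi - phi)).
  apply: csn_avg => // k kn; set s := eps * _ / _.
  have s0 : 0 <= s by rewrite divr_ge0// mulr_ge0// ltW.
  apply: le_trans (H 0 s _ s0 _) => //.
    rewrite add0r le_eqVlt; apply/orP; left; apply/eqP.
    apply: eqN_N; apply: eqNB; first exact: eqN_refl.
    by apply: eqN_sym; exact: (cs_0 cS).
  apply: le_lt_trans er; rewrite ler_pdivrMr// ler_pM2l// ler_nat; exact: ltnW.
rewrite sumrB scalerBr; congr (_ - _).
by rewrite avg_cst.
Qed.

(** Up to less than one mesh, a shift by [h] moves the samples by [j] places.
    Subtracting the original mean leaves only the [j] samples just after [eps]
    and the [j] samples just after 0, whose average difference tends to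
    [S eps phi - S 0 phi]. *)
Lemma riemann_generator v : (forall e, 0 < e ->
    exists M, forall n, (M <= n)%N -> N (riemann n - v) <= e) ->
  is_generator N S v (eps^-1 *: (S eps phi - S 0 phi)).
Proof.
move=> vlim e e0; pose e1 := e * eps / 2.
have e10 : 0 < e1 by rewrite /e1; apply: divr_gt0 => //; exact: mulr_gt0.
have [r r0 H] := orbit_cont e10; exists r => // h h0 hr.
have hle : 0 <= h by exact: ltW.
set K := N (S eps phi - S 0 phi).
have K0 : 0 <= K by exact: csn_ge0.
apply/ler_addgt0Pr => z z0; pose eta := z / (3 + K).
have eta0 : 0 < eta by apply: divr_gt0 => //; lra.
have [M1 M1P] := vlim _ eta0.
have [r' r'0 H'] := orbit_cont eta0.
have [M2 M2P] := div_nat_lt_near eps r'0.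
have [M3 M3P] : exists M, forall n, (M <= n)%N -> (0 < n)%N /\ eps / n%:R < eps * eta.
  by apply: div_nat_lt_near; rewrite mulr_gt0.
(* fine enough for the limit, for the modulus of continuity, and for [j / n]
   to approximate [h / eps] *)
pose n := maxn M1 (maxn M2 M3).
have vn : N (riemann n - v) <= eta by apply: M1P; rewrite leq_maxl.
have [n0 nr'] : (0 < n)%N /\ eps / n%:R < r'.
  by apply: M2P; rewrite /n maxnCA leq_maxl.
have [_ n_eta] : (0 < n)%N /\ eps / n%:R < eps * eta.
  by apply: M3P; rewrite /n maxnA leq_maxr.
have n0' : 0 < n%:R :> R by rewrite ltr0n.
have ninv : n%:R^-1 <= eta by move: n_eta; rewrite ltr_pM2l// => /ltW.
pose j := Num.truncn (h * n%:R / eps).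
have /andP[j1 j2] : j%:R <= h * n%:R / eps < j.+1%:R.
  by apply: truncn_itv; rewrite divr_ge0 ?mulr_ge0// ltW.
pose rho := h - eps * j%:R / n%:R.
have jn : j%:R / n%:R <= h / eps.
  by rewrite ler_pdivrMr// mulrAC.
have j2' : h * n%:R <= eps * j%:R + eps.
  move: j2; rewrite ltr_pdivrMr// -natr1 mulrDl mul1r mulrC => /ltW.
  by rewrite mulrC [eps * _]mulrC.
have jn' : h / eps - j%:R / n%:R <= n%:R^-1.
  rewrite lerBlDl -[X in _ + X]mul1r -mulrDl ler_pdivrMr// mulrAC ler_pdivlMr//.
  by rewrite mulrDl mul1r [_ * eps]mulrC.
have rho0 : 0 <= rho.
  by rewrite /rho subr_ge0 ler_pdivrMr// [eps * _]mulrC -ler_pdivlMr.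
have rho1 : rho < r'.
  by apply: le_lt_trans nr'; rewrite /rho lerBlDl -mulrDl ler_pdivlMr.
pose o i := S (eps * i%:R / n%:R) phi.
pose B := n%:R^-1 *: \sum_(0 <= k < n) o (k + j)%N.
pose c := (j%:R / n%:R) *: (S eps phi - S 0 phi).
have step1 : N (S h v - S h (riemann n)) <= eta.
  by apply: le_trans (cs_lip _ _ hle) _; rewrite csn_C.
have step2 : N (S h (riemann n) - B) <= eta.
  rewrite (@eqN_N _ (n%:R^-1 *: \sum_(0 <= k < n) S h (o k) - B)); last first.
    apply: eqNB; last exact: eqN_refl.
    apply: eqN_trans (cs_eqN_Z _ _ hle) _; apply: eqNZ.
    exact: cs_eqN_sum.
  rewrite /B -scalerBr -sumrB; apply: csn_avg; first exact: ltW.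
  move=> k kn.
  have sk : 0 <= eps * k%:R / n%:R by rewrite divr_ge0// mulr_ge0// ltW.
  have skj : 0 <= eps * (k + j)%:R / n%:R by rewrite divr_ge0// mulr_ge0// ltW.
  apply: le_trans (H' _ rho skj rho0 rho1).
  rewrite le_eqVlt; apply/orP; left; apply/eqP; apply: eqN_N.
  apply: eqNB; last exact: eqN_refl.
  apply: eqN_trans (eqN_sym (cs_semigroup cS _ hle sk)) _.
  rewrite (_ : h + _ = eps * (k + j)%:R / n%:R + rho); first exact: eqN_refl.
  by rewrite /rho natrD; ring.
have step3 : N (B - riemann n - c) <= e * h.
  rewrite /B -scalerBr sumr_nat_shift /c [j%:R / _]mulrC -scalerA -scalerBr.
  rewrite (_ : j%:R *: _ = \sum_(0 <= i < j) (S eps phi - S 0 phi)); last first.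
    by rewrite sumr_const_nat subn0 scaler_nat.
  rewrite -sumrB.
  rewrite (csn_Z cN) ger0_norm ?invr_ge0//.
  apply: (@le_trans _ _ (n%:R^-1 * ((2 * e1) *+ j))).
    rewrite ler_pM2l ?invr_gt0//; apply: csn_sum => i ij.
    rewrite (_ : _ - _ - _ = (o (i + n)%N - S eps phi) - (o i - S 0 phi)); last first.
      by rewrite !opprB addrACA [in RHS]addrACA [- S eps phi + _]addrC.
    have si : 0 <= eps * i%:R / n%:R by rewrite divr_ge0// mulr_ge0// ltW.
    have sir : eps * i%:R / n%:R < r.
      apply: le_lt_trans hr; move: rho0; rewrite /rho subr_ge0; apply: le_trans.
      by rewrite ler_pM2r ?invr_gt0// ler_pM2l// ler_nat ltnW.
    apply: le_trans (csn_D cN _ _) _; rewrite csn_N.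
    have := H 0 _ (lexx 0) si sir; rewrite add0r.
    have := H eps _ (ltW eps0) si sir.
    rewrite /o natrD (_ : eps * (_ + _) / _ = eps + eps * i%:R / n%:R); first lra.
    by field; rewrite gt_eqF.
  rewrite (_ : _ * _ = (j%:R / n%:R) * (e * eps)).
    rewrite (_ : e * h = (h / eps) * (e * eps)); last by field; rewrite gt_eqF.
    by rewrite ler_wpM2r// mulr_ge0// ltW.
  by rewrite -mulr_natl /e1; field; rewrite gt_eqF.
have step4 : N (c - h *: (eps^-1 *: (S eps phi - S 0 phi))) <= eta * K.
  rewrite /c scalerA -scalerBl (csn_Z cN) ler_wpM2r//.
  rewrite distrC ger0_norm ?subr_ge0//; exact: le_trans jn' ninv.
have T1 := csn_triangle (S h (riemann n)) (S h v) B.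
have E1 : S h v - v - h *: (eps^-1 *: (S eps phi - S 0 phi)) =
  (S h v - B) + ((B - riemann n - c) + (riemann n - v) +
  (c - h *: (eps^-1 *: (S eps phi - S 0 phi)))).
  rewrite [B - riemann n - c]addrAC (subrKA (riemann n)) [B - c - v]addrAC.
  by rewrite (subrKA c) -[B - v - _]addrA (subrKA B) addrA.
(* the four errors: shifting the limit, rounding the shift to the mesh, replacing
   the samples by the end values, rounding [h / eps] to [j / n] *)
rewrite E1; apply: le_trans (csn_D cN _ _) _.
have T4 := csn_D cN (B - riemann n - c + (riemann n - v))
  (c - h *: (eps^-1 *: (S eps phi - S 0 phi))).
have T5 := csn_D cN (B - riemann n - c) (riemann n - v).
have : 3 * eta + eta * K = z by rewrite /eta; field; rewrite gt_eqF// ltr_wpDr.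
lra.
Qed.

End Orbit.

(** The means of an orbit over [0, eps] lie in the domain of the generator and
    tend to its starting point as [eps] tends to 0. *)
Lemma generator_dense (phi : V) (e : R) : 0 < e ->
  exists v g, is_generator N S v g /\ N (v - phi) <= e.
Proof.
move=> e0; have e2 : 0 < e / 2 by lra.
have [r r0 H] := orbit_cont phi e2.
have eps0 : 0 < r / 2 by lra.
have epsr : r / 2 < r by lra.
have [v vlim] := riemann_cvg phi eps0.
exists v, ((r / 2)^-1 *: (S (r / 2) phi - S 0 phi)); split.
  exact: riemann_generator vlim.
have [M MP] := vlim _ e2.
apply: le_trans (csn_triangle (riemann phi (r / 2) M.+1) _ _) _.
have := riemann_near eps0 (ltW e2) epsr (ltn0Sn M) H.
by rewrite csn_C; have := MP M.+1 (leqnSn M); lra.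
Qed.

Lemma is_generator_semigroup u g t : 0 <= t ->
  is_generator N S u g -> is_generator N S (S t u) (S t g).
Proof.
move=> t0 ug e /ug[r r0 rP]; exists r => // h h0 hr.
have hh := ltW h0.
apply: le_trans (is_generator_orbit t0 hh (rP h h0 hr)).
rewrite le_eqVlt; apply/orP; left; apply/eqP; apply: eqN_N.
apply: eqNB; last exact: eqN_refl.
apply: eqNB; last exact: eqN_refl.
by apply: eqN_sym; rewrite [t + h]addrC; exact: (cs_semigroup cS).
Qed.

(** Here [Q y] plays the derivative of the convex function [W] at [y]. On the
    domain of the generator the time interval is cut into small steps, on each of
    which convexity bounds the increment of [W] by [Q]; density and the bound on
    [Q] give the general case. *)
Section Lyapunov.
Variables (W : V -> R) (Q : V -> V -> R) (K : R).
Hypotheses (K0 : 0 <= K)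
  (W_convex : forall x y, W y - W x <= Q y (y - x))
  (Q_lin : forall y a z z', Q y (a *: z + z') = a * Q y z + Q y z')
  (Q_bound : forall y z, `|Q y z| <= K * N y * N z)
  (Q_lip : forall x y z, `|Q y z - Q x z| <= K * N (y - x) * N z)
  (Q_gen : forall u g, is_generator N S u g -> Q u g <= 0).

(** The derivative [Q] is nonpositive at time [t], while convexity asks for it at
    time [t + h]; the Lipschitz bound on [Q] pays for the change. *)
Lemma lyapunov_step u g e h t : is_generator N S u g -> 0 <= t -> 0 <= h -> 0 <= e ->
  N (S h u - u - h *: g) <= e * h ->
  W (S (t + h) u) - W (S t u) <= h * (K * N u * e + K * (h * (N g + e)) * N g).
Proof.
move=> ug t0 h0 e0 Hh.
have th0 : 0 <= t + h by rewrite addr_ge0.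
set y := S (t + h) u; set x := S t u; set G := S t g.
have Hy : N (y - x - h *: G) <= e * h := is_generator_orbit t0 h0 Hh.
have Ny : N y <= N u by exact: (cs_contr cS).
have NG : N G <= N g by exact: (cs_contr cS).
have Nyx : N (y - x) <= h * (N g + e).
  rewrite -(subrK (h *: G) (y - x)); apply: le_trans (csn_D cN _ _) _.
  rewrite (csn_Z cN) ger0_norm//.
  have : h * N G <= h * N g by rewrite ler_wpM2l.
  lra.
apply: le_trans (W_convex x y) _.
rewrite -(subrK (h *: G) (y - x)) addrC Q_lin.
have D1 : Q x G <= 0 by apply: Q_gen; exact: is_generator_semigroup.
have D2 := le_trans (ler_norm _) (Q_lip x y G).
have D3 := le_trans (ler_norm _) (Q_bound y (y - x - h *: G)).
have B2 : K * N (y - x) * N G <= K * (h * (N g + e)) * N g.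
  by rewrite ler_pM ?mulr_ge0 ?csn_ge0// ler_wpM2l.
have B3 : K * N y * N (y - x - h *: G) <= K * N u * (e * h).
  by rewrite ler_pM ?mulr_ge0 ?csn_ge0// ler_wpM2l.
have B4 : h * Q y G <= h * (K * (h * (N g + e)) * N g).
  by rewrite ler_wpM2l//; lra.
lra.
Qed.

Lemma lyapunov_domain u g t : is_generator N S u g -> 0 <= t -> W (S t u) <= W u.
Proof.
move=> ug t0.
have W0 : W (S 0 u) <= W u.
  have := le_trans (W_convex u (S 0 u)) (le_trans (ler_norm _) (Q_bound _ _)).
  by rewrite (cs_0 cS) mulr0; lra.
apply: le_trans W0; move: t0; rewrite le_eqVlt => /predU1P[<-//|t0].
apply/ler_addgt0Pr => z z0.
(* half of the slack [z] goes to each of the two error terms of a step *)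
pose e := z / (2 * (t * (K * N u) + 1)).
have Nu := csn_ge0 u; have Ng := csn_ge0 g.
have KN : 0 <= K * N u by exact: mulr_ge0.
have tKN : 0 <= t * (K * N u) by rewrite mulr_ge0// ltW.
have e0 : 0 < e by apply: divr_gt0 => //; lra.
have [r r0 rP] := ug e e0.
pose B := K * (N g + e) * N g.
have B0 : 0 <= B by rewrite !mulr_ge0// addr_ge0// ltW.
have tB : 0 <= t * B by rewrite mulr_ge0// ltW.
pose d := Num.min r (z / (2 * (t * B + 1))).
have d0 : 0 < d by rewrite lt_min r0/=; apply: divr_gt0 => //; lra.
have [M MP] := div_nat_lt_near t d0.
have [_ hd] := MP M.+1 (leqnSn M); set n := M.+1 in hd.
set h := t / n%:R in hd.
have n0 : 0 < n%:R :> R by rewrite ltr0n.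
have h0 : 0 < h by exact: divr_gt0.
have /andP[hr hz] : (h < r) && (h < z / (2 * (t * B + 1))) by rewrite -lt_min.
have Hh := rP h h0 hr.
have step k : W (S (k%:R * h) u) - W (S 0 u) <= k%:R * (h * (K * N u * e + h * B)).
  elim: k => [|k IH]; first by rewrite !mul0r subrr.
  have kh : 0 <= k%:R * h by rewrite mulr_ge0// ltW.
  have := lyapunov_step ug kh (ltW h0) (ltW e0) Hh.
  rewrite -natr1 [(_ + 1) * h]mulrDl [(_ + 1) * (h * _)]mulrDl !mul1r.
  rewrite (_ : K * (h * (N g + e)) * N g = h * B); last by rewrite /B; ring.
  by move: IH; lra.
have := step n.
rewrite /h mulrCA divff ?gt_eqF// mulr1 -/h mulrA [_ * h]mulrC.
rewrite {1}/h divfK ?gt_eqF//.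
suff : t * (K * N u * e + h * B) <= z by lra.
have E1 : t * (K * N u) * e <= z / 2.
  rewrite /e mulrA ler_pdivrMr; last by lra.
  by nra.
have E2 : (t * B) * h <= z / 2.
  apply: le_trans (ler_wpM2l tB (ltW hz)) _.
  rewrite mulrA ler_pdivrMr; last by lra.
  by nra.
lra.
Qed.

Lemma lyapunov_semigroup x t : 0 <= t -> W (S t x) <= W x.
Proof.
move=> t0; have Nx := csn_ge0 x.
apply/ler_addgt0Pr => z z0.
pose A := K * (2 * N x + 1).
have A0 : 0 <= A by apply: mulr_ge0 => //; lra.
pose d := Num.min 1 (z / (A + 1)).
have d0 : 0 < d by rewrite lt_min ltr01/=; apply: divr_gt0 => //; lra.
have d1 : d <= 1 by rewrite ge_min lexx.
have dz : d <= z / (A + 1) by rewrite ge_min lexx orbT.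
have [v [g [vg vx]]] := generator_dense x d0.
have W1 := lyapunov_domain vg t0.
have W2 := le_trans (W_convex (S t v) (S t x)) (le_trans (ler_norm _) (Q_bound _ _)).
have W3 := le_trans (W_convex x v) (le_trans (ler_norm _) (Q_bound _ _)).
have B2 : K * N (S t x) * N (S t x - S t v) <= K * N x * d.
  rewrite ler_pM ?mulr_ge0 ?csn_ge0//; first by rewrite ler_wpM2l// (cs_contr cS).
  by apply: le_trans (cs_lip _ _ t0) _; rewrite csn_C.
have B3 : K * N v * N (v - x) <= K * (N x + 1) * d.
  rewrite ler_pM ?mulr_ge0 ?csn_ge0// ler_wpM2l//.
  by rewrite -(subrK x v) addrC; apply: le_trans (csn_D cN _ _) _; lra.
have : A * d <= z.
  apply: (@le_trans _ _ ((A + 1) * d)); first by rewrite ler_wpM2r ?ltW//; lra.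
  by rewrite mulrC -ler_pdivlMr//; lra.
rewrite /A; nra.
Qed.

End Lyapunov.

End ContractionSemigroup.

(** * A convex penalty for exceeding a level *)

Section Penalty.
Context (R : realType).
Implicit Types x y c r : R.

Definition pospart r : R := Num.max r 0.
(** A function of class C^2 is needed, because its derivative is composed with
    cylindrical functions, which have to stay of class C^1; [s ^+ 3 / (1 + s)] has
    a double zero of the derivative at 0 and a bounded second derivative. *)
Definition penalty r : R := pospart r ^+ 3 / (1 + pospart r).
Definition penalty' r : R :=
  2 * pospart r - 1 + ((1 + pospart r) ^+ 2)^-1.
Definition penalty'' r : R := 2 - 2 * ((1 + pospart r) ^+ 3)^-1.

Lemma pospart_ge0 r : 0 <= pospart r.
Proof. by rewrite le_max lexx orbT. Qed.

Lemma pospart_pos r : 0 <= r -> pospart r = r.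
Proof. by move=> r0; rewrite /pospart max_l. Qed.

Lemma pospart_neg r : r <= 0 -> pospart r = 0.
Proof. by move=> r0; rewrite /pospart max_r. Qed.

Lemma penalty_ge0 r : 0 <= penalty r.
Proof. by have s0 := pospart_ge0 r; rewrite divr_ge0 ?exprn_ge0// addr_ge0. Qed.

Lemma penalty_eq0 r : penalty r = 0 -> r <= 0.
Proof.
have s0 := pospart_ge0 r; move/eqP; rewrite mulf_eq0 expf_eq0/= invr_eq0.
case/orP => [/eqP|/eqP]; last lra.
by rewrite /pospart; case: (leP r 0) => // r0; lra.
Qed.

Lemma penalty_neg r : r <= 0 -> penalty r = 0.
Proof. by move=> r0; rewrite /penalty pospart_neg// expr0n/= mul0r. Qed.

Lemma penalty'_neg r : r <= 0 -> penalty' r = 0.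
Proof. by move=> r0; rewrite /penalty' pospart_neg// addr0 expr1n invr1; lra. Qed.

Lemma penalty'_bounds r : 0 <= penalty' r <= 2 * pospart r.
Proof.
rewrite /penalty'; have := pospart_ge0 r; move: (pospart r) => s s0.
have s1 : 0 < 1 + s by lra.
have i1 : (1 + s)^-1 <= 1 by rewrite invf_le1//; lra.
have i0 : 0 < (1 + s)^-1 by rewrite invr_gt0.
have e : (1 + s) * (1 + s)^-1 = 1 by rewrite mulfV// gt_eqF.
rewrite -exprVn; move: ((1 + s)^-1) i1 i0 e => t i1 i0 e.
by apply/andP; split; nra.
Qed.

Lemma penalty''_bounds r : 0 <= penalty'' r <= 2.
Proof.
rewrite /penalty''; have := pospart_ge0 r; move: (pospart r) => s s0.
have s1 : 1 <= 1 + s by lra.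
have i1 : ((1 + s) ^+ 3)^-1 <= 1 by rewrite invf_le1 ?exprn_gt0 ?exprn_ege1//; lra.
have i0 : 0 <= ((1 + s) ^+ 3)^-1 by rewrite invr_ge0 exprn_ge0//; lra.
by apply/andP; split; lra.
Qed.

Lemma penalty_convex x y : penalty y - penalty x <= penalty' y * (y - x).
Proof.
have [y0|y0] := leP y 0.
  by rewrite penalty_neg// penalty'_neg// mul0r sub0r oppr_le0 penalty_ge0.
have /andP[py0 _] := penalty'_bounds y.
(* a negative [x] is replaced by 0; between nonnegative points the convexity gap
   is an explicit multiple of a square *)
have [xs xs0] : x <= pospart x /\ 0 <= pospart x.
  by rewrite pospart_ge0 le_max lexx.
apply: (@le_trans _ _ (penalty' y * (y - pospart x))); last by rewrite ler_wpM2l//; lra.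
rewrite /penalty' /penalty (pospart_pos (ltW y0)).
move: (pospart x) xs0 => s s0 {xs}.
have a0 : 0 < 1 + s by lra.
have b0 : 0 < 1 + y by lra.
rewrite -subr_ge0 (_ : _ - _ = (y - s) ^+ 2 * (1 - (1 + s)^-1 * ((1 + y) ^+ 2)^-1)).
  rewrite mulr_ge0 ?sqr_ge0// subr_ge0 -invfM invf_le1 ?mulr_gt0 ?exprn_gt0//.
  by rewrite -[1]mul1r ler_pM//; nra.
by field; rewrite !gt_eqF.
Qed.

Lemma pospart_lip x y : `|pospart x - pospart y| <= `|x - y|.
Proof.
rewrite /pospart; case: (leP x 0) => x0; case: (leP y 0) => y0.
- by rewrite subrr normr0.
- by rewrite sub0r normrN !ler_norml; apply/andP; split; 
    rewrite ?(gtr0_norm y0) ?ltr0_norm; lra.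
- by rewrite subr0 (gtr0_norm x0) ger0_norm; lra.
- by [].
Qed.

Lemma penalty'_lip x y : `|penalty' x - penalty' y| <= 2 * `|x - y|.
Proof.
apply: (@le_trans _ _ (2 * `|pospart x - pospart y|)); last first.
  by rewrite ler_pM2l// pospart_lip.
rewrite /penalty'; have := pospart_ge0 x; have := pospart_ge0 y.
move: (pospart x) (pospart y) => a b b0 a0.
wlog ab : a b a0 b0 / b <= a.
  move=> H; have [/H|/ltW/H] := leP b a; first exact.
  by rewrite distrC [X in _ <= 2 * X]distrC; apply.
have a1 : 0 < 1 + a by lra.
have b1 : 0 < 1 + b by lra.
have E : ((1 + b) ^+ 2)^-1 - ((1 + a) ^+ 2)^-1 =
   (a - b) * (((1 + a) ^+ 2)^-1 * (1 + b)^-1 + (1 + a)^-1 * ((1 + b) ^+ 2)^-1).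
  by field; rewrite !gt_eqF.
rewrite (ger0_norm (_ : 0 <= a - b)) ?subr_ge0//.
rewrite (_ : _ - _ = 2 * (a - b) - (((1 + b) ^+ 2)^-1 - ((1 + a) ^+ 2)^-1)); last by ring.
have i1 : (1 + a)^-1 <= 1 by rewrite invf_le1//; lra.
have i2 : (1 + b)^-1 <= 1 by rewrite invf_le1//; lra.
have j1 : 0 < (1 + a)^-1 by rewrite invr_gt0.
have j2 : 0 < (1 + b)^-1 by rewrite invr_gt0.
rewrite E -!exprVn; move: ((1 + a)^-1) ((1 + b)^-1) i1 i2 j1 j2 => p q p1 q1 p0 q0.
have t0 : 0 <= p ^+ 2 * q + p * q ^+ 2 <= 2.
  have : 0 <= p ^+ 2 <= 1 by rewrite sqr_ge0 expr_le1// ltW.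
  have : 0 <= q ^+ 2 <= 1 by rewrite sqr_ge0 expr_le1// ltW.
  by move=> /andP[? ?] /andP[? ?]; apply/andP; split; nra.
by move: t0 => /andP[t0 t2]; rewrite ger0_norm; nra.
Qed.

Lemma pospart_continuous : continuous pospart.
Proof.
move=> r; apply/cvgrPdist_le => e e0; near=> t.
apply: le_trans (pospart_lip _ _) _; near: t.
by apply: cvgr_dist_le.
Unshelve. all: by end_near. Qed.

Lemma pospart1_cvg r : (1 + pospart x) @[x --> r] --> 1 + pospart r.
Proof. by apply: cvgD; [exact: cvg_cst|exact: pospart_continuous]. Qed.

Lemma pospart1_neq0 r : 1 + pospart r != 0.
Proof. by rewrite gt_eqF// ltr_pwDl// pospart_ge0. Qed.

Lemma penalty_continuous : continuous penalty.
Proof.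
move=> r; rewrite /penalty; apply: cvgM.
  apply: (@continuous_comp _ _ _ pospart (fun z => z ^+ 3)).
    exact: pospart_continuous.
  exact: exprn_continuous.
by apply: cvgV; [exact: pospart1_neq0|exact: pospart1_cvg].
Qed.

Lemma penalty''_continuous : continuous penalty''.
Proof.
move=> r; rewrite /penalty''; apply: cvgB; first exact: cvg_cst.
apply: cvgM; first exact: cvg_cst.
apply: cvgV; first by rewrite expf_eq0/=; exact: pospart1_neq0.
apply: (@continuous_comp _ _ _ (fun x => 1 + pospart x) (fun z => z ^+ 3)).
  exact: pospart1_cvg.
exact: exprn_continuous.
Qed.

(** A quadratic remainder gives the derivative at every point at once, including
    the junction at 0. *)
Lemma penalty'_taylor r x :
  `|penalty' x - penalty' r - penalty'' r * (x - r)| <= 3 * (x - r) ^+ 2.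
Proof.
have taylor (a b : R) : 0 <= a -> 0 <= b ->
    `|(2 * a - 1 + ((1 + a) ^+ 2)^-1) - (2 * b - 1 + ((1 + b) ^+ 2)^-1) -
      (2 - 2 * ((1 + b) ^+ 3)^-1) * (a - b)| <= 3 * (a - b) ^+ 2.
  move=> a0 b0; have a1 : 0 < 1 + a by lra.
  have b1 : 0 < 1 + b by lra.
  rewrite (_ : _ - _ - _ = (a - b) ^+ 2 * ((1 + a)^-1 * (1 + b)^-1 ^+ 2 *
    (2 * (1 + b)^-1 + (1 + a)^-1))); last by field; rewrite !gt_eqF.
  have i1 : (1 + a)^-1 <= 1 by rewrite invf_le1//; lra.
  have i2 : (1 + b)^-1 <= 1 by rewrite invf_le1//; lra.
  have j1 : 0 < (1 + a)^-1 by rewrite invr_gt0.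
  have j2 : 0 < (1 + b)^-1 by rewrite invr_gt0.
  move: ((1 + a)^-1) ((1 + b)^-1) i1 i2 j1 j2 => p q p1 q1 p0 q0.
  have q2 : 0 <= q ^+ 2 <= 1 by rewrite sqr_ge0 expr_le1// ltW.
  have pq : 0 <= p * q ^+ 2 <= 1 by move: q2 => /andP[? ?]; apply/andP; split; nra.
  rewrite normrM ger0_norm ?sqr_ge0// mulrC ler_wpM2r ?sqr_ge0//.
  by move: pq => /andP[? ?]; rewrite ger0_norm; nra.
have [r0|r0] := leP r 0.
  have := taylor _ _ (pospart_ge0 x) (lexx 0).
  rewrite (penalty'_neg r0) /penalty'' (pospart_neg r0) !addr0 !expr1n !invr1.
  rewrite !(mulr1, mulr0, subrr, add0r, mul0r, subr0, addNr) -/(penalty' x).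
  move/le_trans; apply.
  rewrite ler_pM2l// -[leRHS]real_normK ?num_real// -[leLHS]real_normK ?num_real//.
  rewrite ler_pXn2r ?nnegrE//; have := pospart_lip x r.
  by rewrite (pospart_neg r0) subr0.
have [x0|x0] := leP x 0; last first.
  have := taylor _ _ (ltW x0) (ltW r0).
  by rewrite /penalty' /penalty'' !pospart_pos// ltW.
have := taylor _ _ (lexx 0) (ltW r0).
rewrite /penalty' /penalty'' (pospart_neg x0) (pospart_pos (ltW r0)).
have r1 : 0 < 1 + r by lra.
have d0 : 0 <= 2 - 2 * ((1 + r) ^+ 3)^-1 <= 6 * r.
  have e : (1 + r) * (1 + r)^-1 = 1 by rewrite mulfV// gt_eqF.
  have i1 : (1 + r)^-1 <= 1 by rewrite invf_le1//; lra.
  have j1 : 0 < (1 + r)^-1 by rewrite invr_gt0.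
  rewrite -exprVn; move: ((1 + r)^-1) e i1 j1 => q e q1 q0.
  have : q ^+ 3 <= 1 by rewrite exprn_ile1// ltW.
  have : 1 - q ^+ 3 = (1 - q) * (1 + q + q ^+ 2) by ring.
  have : 0 <= q ^+ 2 <= 1 by rewrite sqr_ge0 expr_le1// ltW.
  move=> /andP[? ?]; have : 0 <= 1 - q <= r by apply/andP; split; nra.
  by move=> /andP[? ?] => ? ?; apply/andP; split; nra.
move: (2 - 2 * _) d0 => d /andP[d0 d1].
have dx : `|d * x| <= 6 * r * - x by rewrite normrM (ger0_norm d0) (ler0_norm x0); nra.
move: (2 * 0 - 1 + _) (2 * r - 1 + _) => U W T.
rewrite (_ : _ - d * (x - r) = (U - W - d * (0 - r)) - d * x); last by ring.
by apply: le_trans (ler_normB _ _) _; nra.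
Qed.

Lemma penalty'_is_derive r : is_derive r (1 : R) penalty' (penalty'' r).
Proof.
have H : (h^-1 *: ((penalty' \o shift r) (h *: (1 : R)) - penalty' r))
    @[h --> 0^'] --> penalty'' r.
  apply/cvgrPdist_le => e e0; near=> h.
  have h0 : h != 0 by near: h; exact: nbhs_dnbhs_neq.
  have := penalty'_taylor r (h + r); rewrite addrK => T.
  have he : `|h| <= e / 3.
    near: h; apply: dnbhs0_le; exact: divr_gt0.
  rewrite /= [h *: 1]mulr1 distrC.
  rewrite (_ : _ - _ = h^-1 * (penalty' (h + r) - penalty' r - penalty'' r * h)).
    rewrite normrM normfV ler_pdivrMl ?normr_gt0//; apply: le_trans T _.
    rewrite -real_normK ?num_real//; have := normr_ge0 h; nra.
  by rewrite mulrBr mulrCA mulVf// mulr1.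
split; first by apply: cvgP; exact: H.
exact: cvg_lim H.
Unshelve. all: by end_near. Qed.

End Penalty.

Section PenaltyL2.
Context d (T : measurableType d) (R : realType).
Variables (mu : {measure set T -> \bar R}) (c : R).
Hypothesis c0 : 0 <= c.
Implicit Types u v : T -> R.

Lemma penalty'_le_norm (y : R) : `|penalty' (y - c)| <= 2 * `|y|.
Proof.
have /andP[q0 q1] := penalty'_bounds (y - c).
rewrite ger0_norm//; apply: le_trans q1 _; rewrite ler_pM2l// ge_max normr_ge0 andbT.
by rewrite (le_trans _ (ler_norm y))// gerBl.
Qed.

Lemma penalty_le_sqr (y : R) : penalty (y - c) <= 2 * y ^+ 2.
Proof.
have := penalty_convex 0 (y - c); rewrite (penalty_neg (lexx _)) !subr0.
move/le_trans; apply; have /andP[q0 q1] := penalty'_bounds (y - c).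
have [y0|y0] := leP (y - c) 0; first by rewrite penalty'_neg// mul0r mulr_ge0// sqr_ge0.
rewrite (pospart_pos (ltW y0)) in q1.
apply: (@le_trans _ _ (2 * (y - c) * (y - c))); first by rewrite ler_wpM2r// ltW.
by have := mulr_ge0 (ltW y0) c0; have := sqr_ge0 c; nra.
Qed.

Lemma measurable_penalty' u : measurable_fun setT u ->
  measurable_fun setT (fun x => penalty' (u x - c)).
Proof.
move=> mu_; have mq : measurable_fun setT (fun y : R => penalty' (y - c)).
  apply: continuous_measurable_fun => y; apply/cvgrPdist_le => e e0; near=> z.
  apply: le_trans (penalty'_lip _ _) _.
  rewrite (_ : y - c - (z - c) = y - z); last by ring.
  rewrite -ler_pdivlMl//; near: z; apply: cvgr_dist_le => //.
  by rewrite mulr_gt0.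
exact: measurableT_comp mq mu_.
Unshelve. all: by end_near. Qed.

Lemma penalty'_L2 u : L2 mu u -> L2 mu (fun x => penalty' (u x - c)).
Proof.
move=> Lu; apply: (L2_dominated _ (L2Z 2 Lu)).
  exact/measurable_penalty'/L2_measurable/Lu.
move=> x; rewrite -real_normK ?num_real// -[leRHS]real_normK ?num_real//.
rewrite ler_pXn2r ?nnegrE// normrM (ger0_norm (ler0n _ 2)); exact: penalty'_le_norm.
Qed.

Lemma nrm_penalty'_le u : L2 mu u ->
  nrm mu (fun x => penalty' (u x - c)) <= 2 * nrm mu u.
Proof.
move=> Lu; rewrite -[X in X * _](@ger0_norm _ 2)// -nrmZ//.
apply: nrm_dominated; [exact: penalty'_L2|exact: L2Z|move=> x].
by rewrite normrM (ger0_norm (ler0n _ 2)) penalty'_le_norm.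
Qed.

Lemma nrm_penalty'_lip u v : L2 mu u -> L2 mu v ->
  nrm mu (fun x => penalty' (u x - c) - penalty' (v x - c)) <=
  2 * nrm mu (fun x => u x - v x).
Proof.
move=> Lu Lv; have Luv := L2B Lu Lv.
rewrite -[X in X * _](@ger0_norm _ 2)// -nrmZ//.
apply: nrm_dominated; [by apply: L2B; exact: penalty'_L2|exact: L2Z|move=> x].
rewrite normrM (ger0_norm (ler0n _ 2)); apply: le_trans (penalty'_lip _ _) _.
by rewrite (_ : u x - c - _ = u x - v x)//; ring.
Qed.

Lemma penalty_integrable u : L2 mu u ->
  mu.-integrable setT (EFin \o (fun x => penalty (u x - c))).
Proof.
move=> Lu.
have := integrable_EFinZl 2 (L2_sqr_integrable Lu).
apply: le_integrable => //.
  have mc : measurable_fun setT (fun x => u x - c).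
    by apply: measurable_funB => //; exact: L2_measurable Lu.
  apply/measurable_EFinP; apply: measurableT_comp mc.
  by apply: continuous_measurable_fun; exact: penalty_continuous.
move=> x _ /=; rewrite lee_fin ger0_norm ?penalty_ge0//.
exact: le_trans (penalty_le_sqr _) (ler_norm _).
Qed.

Lemma penalty_integral_convex u v : L2 mu u -> L2 mu v ->
  \int[mu]_x penalty (v x - c) - \int[mu]_x penalty (u x - c) <=
  ip mu (fun x => penalty' (v x - c)) (fun x => v x - u x).
Proof.
move=> Lu Lv; rewrite -RintegralB//; try exact: penalty_integrable.
apply: le_Rintegral => //.
- have := integrableB measurableT (penalty_integrable Lv) (penalty_integrable Lu).
  by apply: eq_integrable => // x _; rewrite /= EFinB.
- by apply: L2_mul_integrable; [exact: penalty'_L2|exact: L2B].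
move=> x _; have := penalty_convex (u x - c) (v x - c).
by rewrite (_ : v x - c - (u x - c) = v x - u x)//; ring.
Qed.

End PenaltyL2.

(** * The Cameron-Martin space *)

Section SecondMoment.
Context (R : realType).

(** The quotient of the two Gaussian functions is the exponential of the term that
    is added to 1 here. *)
Lemma normal_fun_tail (m s y : R) : s != 0 ->
  normal_fun m s y * (1 + 3 / 8 * (y - m) ^+ 2 / s ^+ 2) <= normal_fun m (2 * s) y.
Proof.
move=> s0; rewrite /normal_fun.
set k := 3 / 8 * _ / _.
rewrite (_ : - (y - m) ^+ 2 / ((2 * s) ^+ 2 *+ 2) = - (y - m) ^+ 2 / (s ^+ 2 *+ 2) + k).
  by rewrite expRD ler_wpM2l ?expR_ge0// expR_ge1Dx.
by rewrite /k; field.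
Qed.

Lemma normal_pdf_tail (m s : R) : s != 0 -> exists2 C, 0 <= C &
  forall y, (`|y| + 1) ^+ 2 * normal_pdf m s y <= C * normal_pdf m (2 * s) y.
Proof.
move=> s0; have s20 : 2 * s != 0 by rewrite mulf_neq0.
have s2 : 0 < s ^+ 2 by rewrite exprn_even_gt0.
(* With [z = |y - m|] and [a = |m| + 1], the product of [B] and
   [1 + 3 / 8 * z ^+ 2 / s ^+ 2] dominates [2 * z ^+ 2 + 2 * a ^+ 2], which
   dominates [(z + a) ^+ 2]. *)
pose B := 16 / 3 * s ^+ 2 + 2 * (`|m| + 1) ^+ 2.
have B0 : 0 <= B.
  by rewrite addr_ge0// mulr_ge0// ?divr_ge0// ?sqr_ge0// ltW.
exists (B * (normal_peak s / normal_peak (2 * s))) => [|y].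
  by rewrite mulr_ge0// divr_ge0 ?normal_peak_ge0.
rewrite /normal_pdf (negbTE s0) (negbTE s20).
have p2 : 0 < normal_peak (2 * s) by rewrite normal_peak_gt0.
have p1 := normal_peak_ge0 s.
rewrite [leRHS](_ : _ = normal_peak s * (B * normal_fun m (2 * s) y)); last first.
  by field; rewrite gt_eqF.
rewrite mulrCA ler_wpM2l//.
apply: le_trans (ler_wpM2l B0 (normal_fun_tail m y s0)).
rewrite mulrCA mulrC ler_wpM2l ?normal_fun_ge0//.
have yz : `|y| + 1 <= `|y - m| + (`|m| + 1).
  by rewrite addrA lerD2r -{1}(subrK m y) ler_normD.
have : (`|y| + 1) ^+ 2 <= (`|y - m| + (`|m| + 1)) ^+ 2.
  by rewrite ler_pXn2r// nnegrE ?addr_ge0.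
move/le_trans; apply.
rewrite -[(y - m) ^+ 2]real_normK ?num_real//.
move: `|y - m| (normr_ge0 (y - m)) => z z0.
have : 0 <= `|m| + 1 by rewrite addr_ge0.
rewrite /B; move: (`|m| + 1) => a a0.
rewrite [leRHS](_ : _ = 2 * z ^+ 2 + 2 * a ^+ 2 +
  (16 / 3 * s ^+ 2 + 3 / 4 * a ^+ 2 * z ^+ 2 / s ^+ 2)).
  apply: (@le_trans _ _ (2 * z ^+ 2 + 2 * a ^+ 2)).
    by have := sqr_ge0 (z - a); rewrite sqrrB sqrrD; lra.
  have q0 : 0 <= a ^+ 2 * z ^+ 2 / s ^+ 2.
    by apply: divr_ge0; [apply: mulr_ge0|]; exact: sqr_ge0.
  by rewrite lerDl -!(mulrA (3 / 4)); lra.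
by field.
Qed.

(** Slicing the line into the shells n <= |y| < n + 1 compares the second moment
    with the total mass of a normal law of larger variance. *)
Lemma normal_second_moment (mu : {measure set R -> \bar R}) (m s : R) : s != 0 ->
  (forall A : set R, measurable A -> mu A = normal_prob m s A) ->
  (\int[mu]_y (y ^+ 2)%:E < +oo)%E.
Proof.
move=> s0 muE; have [C C0 CP] := normal_pdf_tail m s0.
pose A n := [set y : R | n%:R <= `|y| < n.+1%:R].
have mA n : measurable (A n).
  rewrite (_ : A n = (fun y : R => `|y|) @^-1` `[n%:R, n.+1%:R[%classic); last first.
    by apply/seteqP; split => y /=; rewrite in_itv.
  by rewrite -[_ @^-1` _]setTI; exact: normr_measurable.
have tA : trivIset setT A.
  move=> i j _ _ [y [/andP[iy yi] /andP[jy yj]]].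
  have := le_lt_trans iy yj; have := le_lt_trans jy yi.
  by rewrite !ltr_nat !ltnS => ji ij; apply/eqP; rewrite eqn_leq ij ji.
have UA : \bigcup_n A n = setT.
  apply/seteqP; split => // y _; exists (Num.truncn `|y|) => //=.
  exact: truncn_itv.
have mp (a : R) : measurable_fun [set: R] (fun y : R => (normal_pdf m a y)%:E).
  by apply/measurable_EFinP; exact: measurable_normal_pdf.
have p0 (a y : R) : (0 <= (normal_pdf m a y)%:E)%E by rewrite lee_fin normal_pdf_ge0.
rewrite -UA ge0_integral_bigcup//; last 2 first.
- by apply: measurable_funTS; apply/measurable_EFinP; exact: measurable_funX.
- by move=> x _; rewrite lee_fin sqr_ge0.
apply: (@le_lt_trans _ _ (\int[lebesgue_measure]_(y in \bigcup_n A n)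
  (C * normal_pdf m (2 * s) y)%:E)%E).
  rewrite ge0_integral_bigcup//; last 2 first.
  - apply: measurable_funTS; apply/measurable_EFinP; apply: measurable_funM => //.
    exact: measurable_normal_pdf.
  - by move=> y _; rewrite lee_fin mulr_ge0// normal_pdf_ge0.
  apply: lee_nneseries => [n _ _|n _].
    by apply: integral_ge0 => y _; rewrite lee_fin sqr_ge0.
  apply: (@le_trans _ _ (\int[mu]_(y in A n) ((n.+1%:R) ^+ 2)%:E)%E).
    apply: ge0_le_integral => //.
    - by move=> y _; rewrite lee_fin sqr_ge0.
    - by apply: measurable_funTS; apply/measurable_EFinP; exact: measurable_funX.
    - move=> y /andP[_ yn]; rewrite lee_fin -(real_normK (num_real y)).
      by rewrite ler_pXn2r ?nnegrE// ltW.
  rewrite integral_cst; last exact: mA.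
  rewrite muE//= /normal_prob.
  rewrite -ge0_integralZl//; last 2 first.
  - exact: mA.
  - exact: (measurable_funTS (mp s)).
  apply: ge0_le_integral => //; first exact: mA.
  - by move=> y _; rewrite mule_ge0// lee_fin sqr_ge0.
  - apply: measurable_funTS; apply: emeasurable_funM => //; exact: mp.
  - apply: measurable_funTS; apply/measurable_EFinP; apply: measurable_funM => //.
    exact: measurable_normal_pdf.
  - move=> y /andP[ny _]; rewrite -EFinM lee_fin; apply: le_trans (CP y).
    rewrite ler_wpM2r ?normal_pdf_ge0// ler_pXn2r ?nnegrE ?addr_ge0//.
    by rewrite -natr1 lerD2r.
rewrite UA; under eq_integral do rewrite EFinM.
rewrite ge0_integralZl//=; last exact: mp.
by rewrite integral_normal_pdf mule1 ltry.
Qed.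

End SecondMoment.

Lemma continuous_borel_measurable (R : realType) (X : ptopologicalType) (f : X -> R) :
  continuous f -> measurable_fun setT (f : borel X -> R).
Proof.
move=> cf; apply: (measurability _ (RGenOpens.measurableE R)) => _ [_ [a [b ->]] <-].
rewrite setTI; apply: open_borel; apply: open_comp; last exact: interval_open.
by move=> x _; exact: cf.
Qed.

Section CameronMartinSpace.
Context (R : realType) (X : completeNormedModType R).
Variable gamma : probability (borel X) R.
Hypothesis gaussian : gaussian_measure gamma.
Local Notation CM := (cameron_martin gamma).
Local Notation dotH := (dotH gamma).
Local Notation normH := (normH gamma).
Local Notation hat := (hat gamma).
Local Notation ip := (ip gamma).
Local Notation nrm := (nrm gamma).

Lemma dual_L2 l : dual X l -> L2 gamma l.
Proof.
move=> dl; have [_ lc] := dl.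
have ml : measurable_fun setT (l : borel X -> R) by exact: continuous_borel_measurable.
have [m [s lE]] := gaussian dl.
apply: L2_bounded_sqr => //.
have msq : measurable_fun setT (fun y : R => (y ^+ 2)%:E).
  by apply/measurable_EFinP; exact: measurable_funX.
have -> : (\int[gamma]_x (l x ^+ 2)%:E =
    \int[pushforward gamma (l : borel X -> R)]_y (y ^+ 2)%:E)%E.
  rewrite ge0_integral_pushforward ?preimage_setT// => y _.
  by rewrite lee_fin sqr_ge0.
move: lE; rewrite /gaussian_law; have [_ lE|s0 lE] := eqVneq s 0.
  rewrite (@eq_measure_integral _ _ _ _ (\d_m)) => [|A mA _]; last exact: lE.
  by rewrite integral_dirac//= diracT mul1e ltry.
apply: normal_second_moment s0 _; exact: lE.
Qed.

Lemma dual_lin a l1 l2 : dual X l1 -> dual X l2 -> dual X (fun x => a * l1 x + l2 x).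
Proof.
move=> [L1 c1] [L2 c2]; split.
  by move=> b x y /=; rewrite L1 L2; ring.
by move=> x; apply: cvgD; [apply: cvgM => //; [exact: cvg_cst|exact: c1]|exact: c2].
Qed.

Lemma dual0 : dual X (fun=> 0).
Proof. by split => [a x y|]; [rewrite mulr0 addr0|exact: cst_continuous]. Qed.

Lemma dual_closureP f : dual_closure gamma f <->
  L2 gamma f /\ forall e, 0 < e -> exists2 l, dual X l & nrm (fun x => f x - l x) < e.
Proof.
split=> -[Lf H]; split=> // e /H[l dl le]; exists l => //; move: le;
  by rewrite L2normE ?lte_fin//; apply: L2B => //; exact: dual_L2.
Qed.

Lemma dual_closure_lin a f g : dual_closure gamma f -> dual_closure gamma g ->
  dual_closure gamma (fun x => a * f x + g x).
Proof.
move=> /dual_closureP[Lf Hf] /dual_closureP[Lg Hg]; apply/dual_closureP.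
split; first exact: L2_lin.
move=> e e0; have k0 : 0 < e / (2 * (`|a| + 1)) by rewrite divr_gt0// mulr_gt0// ltr_wpDl.
have [l dl le] := Hf _ k0; have [k dk ke] := Hg _ (divr_gt0 e0 (@ltr0Sn R 1)).
exists (fun x => a * l x + k x); first exact: dual_lin.
have Ll := dual_L2 dl; have Lk := dual_L2 dk.
rewrite (_ : (fun x => _) = (fun x => a * (f x - l x) + (g x - k x))); last first.
  by apply/funext => x; ring.
apply: le_lt_trans (nrmD _ _) _; [by apply: L2Z; exact: L2B|exact: L2B|].
rewrite nrmZ; last exact: L2B.
have : `|a| * nrm (fun x => f x - l x) <= (`|a| + 1) * (e / (2 * (`|a| + 1))).
  by apply: ler_pM; rewrite ?nrm_ge0 ?lerDl ?(ltW le).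
rewrite [X in _ <= X -> _](_ : _ = e / 2); last first.
  by field; rewrite gt_eqF// ltr_wpDl.
lra.
Qed.

Lemma is_Rgamma_lin a f g h k : dual_closure gamma f -> dual_closure gamma g ->
  is_Rgamma gamma f h -> is_Rgamma gamma g k ->
  is_Rgamma gamma (fun x => a * f x + g x) (a *: h + k).
Proof.
move=> [Lf _] [Lg _] fh gk l dl; have [-> _] := dl.
rewrite fh// gk//; symmetry; exact: (ip_lin _ Lf Lg (dual_L2 dl)).
Qed.

(** The difference of the two functions is orthogonal to the dual, and it is a
    limit of elements of the dual. *)
Lemma is_Rgamma_inj f g h : dual_closure gamma f -> dual_closure gamma g ->
  is_Rgamma gamma f h -> is_Rgamma gamma g h -> f = g %[ae gamma].
Proof.
move=> cf cg fh gh.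
have /dual_closureP[Ld Hd] := dual_closure_lin (-1) cg cf.
have d0 l : dual X l -> ip (fun x => -1 * g x + f x) l = 0.
  move=> dl; rewrite ip_lin; [|exact: cg.1|exact: cf.1|exact: dual_L2].
  have -> : ip f l = l h by rewrite (fh l dl).
  by have -> : ip g l = l h; [rewrite (gh l dl)|rewrite mulN1r addNr].
suff n0 : nrm (fun x => -1 * g x + f x) = 0.
  have := nrm_eq0 Ld n0; apply: filterS => x /= /(_ I) /eqP fg _.
  by apply/eqP; rewrite -subr_eq0 addrC -mulN1r.
apply: le_anti; rewrite nrm_ge0 andbT; apply/ler_addgt0Pr => e e0; rewrite add0r.
have [l dl /ltW le] := Hd e e0; have Ll := dual_L2 dl.
have [n0|n_gt0] := leP (nrm (fun x => -1 * g x + f x)) 0.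
  by apply: le_trans n0 _; exact: ltW.
rewrite -(ler_pM2l n_gt0) -expr2 nrm_sqr.
rewrite -[leLHS]subr0 -(d0 l dl) -ipBr//.
apply: le_trans (ler_norm _) _; apply: le_trans (ip_le_nrm Ld (L2B Ld Ll)) _.
by rewrite ler_wpM2l ?nrm_ge0.
Qed.

Lemma hatP h : CM h -> dual_closure gamma (hat h) /\ is_Rgamma gamma (hat h) h.
Proof.
by move=> [f cf fh]; rewrite /Defs.hat; case: xgetP => [g -> //|/(_ f)]; case.
Qed.

Lemma hat_L2 h : CM h -> L2 gamma (hat h).
Proof. by move=> /hatP[[]]. Qed.

Lemma CM_lin a h k : CM h -> CM k -> CM (a *: h + k).
Proof.
move=> /hatP[ch hh] /hatP[ck kk]; exists (fun x => a * hat h x + hat k x).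
  exact: dual_closure_lin.
exact: is_Rgamma_lin.
Qed.

Lemma CM0 : CM 0.
Proof.
exists (fun=> 0).
  apply/dual_closureP; split; first exact: L2_cst0.
  move=> e e0; exists (fun=> 0); first exact: dual0.
  have -> : (fun x : X => 0 - 0 : R) = (fun=> 0) by apply/funext => x; rewrite subr0.
  rewrite ae_eq0_nrm//; [exact: L2_cst0|exact: ae_eq_refl].
move=> l [ll _]; have := ll 0 0 0; rewrite scale0r addr0 mul0r add0r.
under eq_Rintegral do rewrite mul0r.
rewrite Rintegral_cst// mul0r.
have := ll 1 0 0; rewrite scale1r addr0 mul1r => /esym/eqP.
by rewrite -subr_eq0 addrK => /eqP.
Qed.

Lemma CMZ a h : CM h -> CM (a *: h).
Proof. by move=> Hh; rewrite -[_ *: _]addr0; apply: CM_lin => //; exact: CM0. Qed.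

Lemma CMD h k : CM h -> CM k -> CM (h + k).
Proof. by move=> Hh Hk; rewrite -[h]scale1r; exact: CM_lin. Qed.

Lemma CMB h k : CM h -> CM k -> CM (h - k).
Proof. by move=> Hh Hk; rewrite addrC -scaleN1r; exact: CM_lin. Qed.

(** [hat] chooses a representative, so it is linear only up to null sets. *)
Lemma hat_lin a h k : CM h -> CM k ->
  hat (a *: h + k) = (fun x => a * hat h x + hat k x) %[ae gamma].
Proof.
move=> Hh Hk; have [c1 r1] := hatP (CM_lin a Hh Hk).
have [ch hh] := hatP Hh; have [ck kk] := hatP Hk.
apply: (is_Rgamma_inj c1 _ r1); first exact: dual_closure_lin.
exact: is_Rgamma_lin.
Qed.

Lemma dotHC h k : dotH h k = dotH k h.
Proof. exact: ipC. Qed.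

Lemma dotH_lin a h k z : CM h -> CM k -> CM z ->
  dotH (a *: h + k) z = a * dotH h z + dotH k z.
Proof.
move=> Hh Hk Hz; have Lh := hat_L2 Hh; have Lk := hat_L2 Hk; have Lz := hat_L2 Hz.
rewrite -(ip_lin _ Lh Lk Lz) /Defs.dotH.
apply: (ae_eq_ip (hat_lin a Hh Hk) (ae_eq_refl _ _ _)) => //.
- by apply: hat_L2; exact: CM_lin.
- exact: L2_lin.
Qed.

Lemma dotHZ a h k : CM h -> CM k -> dotH (a *: h) k = a * dotH h k.
Proof.
move=> Hh Hk; have := dotH_lin 0 Hk Hk Hk; have := dotH_lin a Hh CM0 Hk.
rewrite addr0 => ->; have := dotH_lin 0 CM0 CM0 Hk; have := dotH_lin 1 CM0 CM0 Hk.
rewrite scale1r addr0 mul1r; lra.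
Qed.

Lemma dotHD h k z : CM h -> CM k -> CM z -> dotH (h + k) z = dotH h z + dotH k z.
Proof. by move=> *; rewrite -[h in LHS]scale1r dotH_lin// mul1r. Qed.

Lemma dotHB h k z : CM h -> CM k -> CM z -> dotH (h - k) z = dotH h z - dotH k z.
Proof. by move=> *; rewrite addrC -scaleN1r dotH_lin// mulN1r addrC. Qed.

Lemma normH_sqr h : normH h ^+ 2 = dotH h h.
Proof. exact: nrm_sqr. Qed.

Lemma normH_ge0 h : 0 <= normH h.
Proof. exact: sqrtr_ge0. Qed.

Lemma dotH_le h k : CM h -> CM k -> `|dotH h k| <= normH h * normH k.
Proof. by move=> Hh Hk; apply: ip_le_nrm; exact: hat_L2. Qed.

Lemma normHZ a h : CM h -> normH (a *: h) = `|a| * normH h.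
Proof.
move=> Hh; rewrite /Defs.normH dotHZ// ?[dotH h _]dotHC ?dotHZ//; last exact: CMZ.
by rewrite mulrA -expr2 sqrtrM ?sqr_ge0// sqrtr_sqr.
Qed.

Lemma normHB_sqr h k : CM h -> CM k ->
  normH (h - k) ^+ 2 = normH h ^+ 2 - 2 * dotH h k + normH k ^+ 2.
Proof.
move=> Hh Hk; have Hhk := CMB Hh Hk.
by rewrite !normH_sqr dotHB// ![dotH _ (h - k)]dotHC !dotHB// (dotHC k h); lra.
Qed.

Lemma normHD_sqr h k : CM h -> CM k ->
  normH (h + k) ^+ 2 = normH h ^+ 2 + 2 * dotH h k + normH k ^+ 2.
Proof.
move=> Hh Hk; have Hhk := CMD Hh Hk.
by rewrite !normH_sqr dotHD// ![dotH _ (h + k)]dotHC !dotHD// (dotHC k h); lra.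
Qed.

Lemma normHD h k : CM h -> CM k -> normH (h + k) <= normH h + normH k.
Proof.
move=> Hh Hk; rewrite -(@ler_pXn2r _ 2)// ?nnegrE ?addr_ge0 ?normH_ge0//.
by rewrite normHD_sqr//; have := dotH_le Hh Hk; move/(le_trans (ler_norm _)); nra.
Qed.

End CameronMartinSpace.

(** * Functions with values in the Cameron-Martin space *)

Import HBNNSimple.

Section HValued.
Context (R : realType) (X : completeNormedModType R).
Variable gamma : probability (borel X) R.
Hypothesis gaussian : gaussian_measure gamma.
Local Notation CM := (cameron_martin gamma).
Local Notation dotH := (dotH gamma).
Local Notation normH := (normH gamma).
Local Notation H_simple := (H_simple gamma).
Local Notation H_strongly_measurable := (H_strongly_measurable gamma).

Lemma CM_sum m (F : 'I_m -> X) : (forall i, CM (F i)) -> CM (\sum_(i < m) F i).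
Proof. by move=> HF; apply: big_ind => //; [exact: CM0|exact: CMD]. Qed.

Lemma dotH_sum m (F : 'I_m -> X) k : (forall i, CM (F i)) -> CM k ->
  dotH (\sum_(i < m) F i) k = \sum_(i < m) dotH (F i) k.
Proof.
move=> HF Hk; suff [] : CM (\sum_(i < m) F i) /\
  dotH (\sum_(i < m) F i) k = \sum_(i < m) dotH (F i) k by [].
apply: (big_rec2 (fun x y => CM x /\ dotH x k = y)).
  by split; [exact: CM0|rewrite -(scale0r 0) dotHZ ?mul0r//; exact: CM0].
by move=> i x y _ [Hx <-]; split; [exact: CMD|rewrite dotHD].
Qed.

Lemma H_simple_CM s x : H_simple s -> CM (s x).
Proof. by move=> [m [A [h [_ hH ->]]]]; apply: CM_sum => i; exact: CMZ. Qed.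

Lemma H_simple_0 : H_simple (fun=> 0).
Proof.
exists 0%N, (fun=> set0), (fun=> 0); split=> [[]//|[]//|].
by apply/funext => x; rewrite big_ord0.
Qed.

Lemma H_simple_add s t : H_simple s -> H_simple t -> H_simple (fun x => s x + t x).
Proof.
move=> [m [A [h [mA hH ->]]]] [n [B [k [mB kH ->]]]].
exists (m + n)%N, (fun i => match fintype.split i with inl i => A i | inr j => B j end),
  (fun i => match fintype.split i with inl i => h i | inr j => k j end); split.
- by move=> i; case: (fintype.split i).
- by move=> i; case: (fintype.split i).
apply/funext => x; rewrite big_split_ord/=; congr (_ + _); apply: eq_bigr => i _.
  by rewrite (unsplitK (inl i)).
by rewrite (unsplitK (inr i)).
Qed.

Lemma H_simple_indic (A : set (borel X)) c s : measurable A -> H_simple s ->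
  H_simple (fun x => (c * \1_A x) *: s x).
Proof.
move=> mA [m [B [h [mB hH ->]]]].
exists m, (fun i => A `&` B i), (fun i => c *: h i); split.
- by move=> i; exact: measurableI.
- by move=> i; exact: CMZ.
apply/funext => x; rewrite scaler_sumr; apply: eq_bigr => i _.
by rewrite indicI /= !scalerA; congr (_ *: _); ring.
Qed.

(** A simple scalar function is a finite combination of indicators, each of which
    only refines the partition of a simple function. *)
Lemma H_simple_scale (a : {nnsfun borel X >-> R}) s : H_simple s ->
  H_simple (fun x => a x *: s x).
Proof.
move=> Hs; rewrite (_ : (fun x => _) = (fun x =>
  (\sum_(y <- finmap.enum_fset (fset_set (range a)))
    y * \1_(a @^-1` [set y]) x) *: s x)); last first.
  by apply/funext => x; rewrite fimfunE fsbig_finite//; exact: fimfunP.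
elim: (finmap.enum_fset _) => [|y r IH].
  rewrite (_ : (fun x => _) = (fun=> 0)); first exact: H_simple_0.
  by apply/funext => x; rewrite big_nil scale0r.
rewrite (_ : (fun x => _) = (fun x => (y * \1_(a @^-1` [set y]) x) *: s x +
  (\sum_(y <- r) y * \1_(a @^-1` [set y]) x) *: s x)).
  by apply: H_simple_add => //; apply: H_simple_indic => //; exact: measurable_sfunP.
by apply/funext => x; rewrite big_cons scalerDl.
Qed.

Lemma measurable_dotH_simple s t : H_simple s -> H_simple t ->
  measurable_fun setT (fun x : borel X => dotH (s x) (t x)).
Proof.
move=> [m [A [h [mA hH ->]]]] [n [B [k [mB kH ->]]]].
rewrite (_ : (fun x => _) = (fun x : borel X => \sum_(i < m) \sum_(j < n)
  ((\1_(A i) x : R) * \1_(B j) x) * dotH (h i) (k j))).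
  apply: measurable_sum => i; apply: measurable_sum => j.
  by apply: measurable_funM => //; apply: measurable_funM; exact: measurable_indic.
apply/funext => x; have HB : CM (\sum_(j < n) (\1_(B j) x : R) *: k j).
  by apply: CM_sum => j; exact: CMZ.
rewrite dotH_sum// => [|i]; last exact: CMZ.
apply: eq_bigr => i _; rewrite dotHZ// dotHC dotH_sum// => [|j]; last exact: CMZ.
rewrite mulr_sumr; apply: eq_bigr => j _.
by rewrite dotHZ// dotHC mulrA.
Qed.

Lemma dotH_cvg (s t : nat -> X) (h k : X) :
  (forall n, CM (s n)) -> (forall n, CM (t n)) -> CM h -> CM k ->
  normH (s n - h) @[n --> \oo] --> 0 -> normH (t n - k) @[n --> \oo] --> 0 ->
  dotH (s n) (t n) @[n --> \oo] --> dotH h k.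
Proof.
move=> Hs Ht Hh Hk sh tk; apply/subr_cvg0/norm_cvg0P.
apply: (@squeeze_cvgr _ _ _ _ (fun=> 0) (fun n => normH (s n - h) *
  (normH (t n - k) + normH k) + normH h * normH (t n - k))); last 2 first.
- exact: cvg_cst.
- rewrite [X in _ --> X](_ : _ = 0 * (0 + normH k) + normH h * 0); last first.
    by rewrite mul0r mulr0 addr0.
  apply: cvgD; apply: cvgM => //; last exact: cvg_cst.
  by apply: cvgD => //; exact: cvg_cst.
apply: nearW => n; rewrite normr_ge0/=.
have Hsh : CM (s n - h) by exact: CMB.
have Htk : CM (t n - k) by exact: CMB.
have -> : dotH (s n) (t n) - dotH h k = dotH (s n - h) (t n) + dotH h (t n - k).
  by rewrite dotHB// [dotH h (_ - _)]dotHC dotHB// !(dotHC _ _ h); lra.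
apply: le_trans (ler_normD _ _) _; apply: lerD.
  apply: le_trans (dotH_le Hsh (Ht n)) _.
  rewrite ler_wpM2l ?normH_ge0// -{1}(subrK k (t n)); exact: normHD.
exact: dotH_le.
Qed.

(** Pointwise limit of the measurable functions given by simple approximations. *)
Lemma measurable_dotH F G : (forall x, CM (F x)) -> (forall x, CM (G x)) ->
  H_strongly_measurable F -> H_strongly_measurable G ->
  measurable_fun setT (fun x : borel X => dotH (F x) (G x)).
Proof.
move=> HF HG [s Hs sF] [t Ht tG].
apply: (@measurable_fun_cvg _ _ _ _ (fun n (x : borel X) => dotH (s n x) (t n x))).
  by move=> n; exact: measurable_dotH_simple.
by move=> x _; apply: dotH_cvg => // n; exact: H_simple_CM.
Qed.

Variable mu : {measure set (borel X) -> \bar R}.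
Local Notation integr f := (mu.-integrable setT (fun x : borel X => (f x)%:E)).

Lemma L2H_normH_integrable F : L2H gamma mu F -> integr (fun x => normH (F x) ^+ 2).
Proof.
move=> [HF mF iF]; apply/integrableP; split.
  apply/measurable_EFinP; under eq_fun do rewrite normH_sqr.
  exact: measurable_dotH.
by under eq_integral do rewrite gee0_abs ?lee_fin ?sqr_ge0//.
Qed.

Lemma L2H_dotH_integrable F G : L2H gamma mu F -> L2H gamma mu G ->
  integr (fun x => dotH (F x) (G x)).
Proof.
move=> LF LG; have [HF mF _] := LF; have [HG mG _] := LG.
apply: (@le_integrable _ _ _ mu _ _ _
  (fun x => (normH (F x) ^+ 2)%:E + (normH (G x) ^+ 2)%:E)%E) => //.
- by apply/measurable_EFinP; exact: measurable_dotH.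
- move=> x _; rewrite /= lee_fin; apply: le_trans (dotH_le (HF x) (HG x)) _.
  have : 0 <= normH (F x) by exact: normH_ge0.
  have : 0 <= normH (G x) by exact: normH_ge0.
  move: (normH _) (normH _) => a b a0 b0.
  by rewrite (ger0_norm (addr_ge0 _ _)) ?sqr_ge0//; nra.
- by apply: integrableD => //; exact: L2H_normH_integrable.
Qed.

(** Products of simple approximations of the two factors approximate the
    product strongly. *)
Lemma L2H_scale (a : X -> R) (K : R) G :
  measurable_fun setT (a : borel X -> R) -> (forall x, 0 <= a x <= K) ->
  L2H gamma mu G -> L2H gamma mu (fun x => a x *: G x).
Proof.
move=> ma aK LG; have [HG mG iG] := LG; have a0 x : 0 <= a x by have /andP[] := aK x.
have mE : measurable_fun setT (fun x : borel X => (a x)%:E) by exact/measurable_EFinP.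
pose an := nnsfun_approx measurableT mE.
have an_cvg x : an n x @[n --> \oo] --> a x.
  have aE0 y : setT y -> (0 <= (a y)%:E)%E by rewrite lee_fin.
  exact: fine_cvg (cvg_nnsfun_approx measurableT mE aE0 I).
split; first by move=> x; exact: CMZ.
  case: mG => s Hs sG; exists (fun n x => an n x *: s n x).
    by move=> n; exact: H_simple_scale.
  move=> x.
  have Hsn n : CM (s n x) by exact: H_simple_CM.
  apply: (@squeeze_cvgr _ _ _ _ (fun=> 0) (fun n =>
    `|an n x| * normH (s n x - G x) + `|an n x - a x| * normH (G x))).
  - apply: nearW => n; rewrite normH_ge0/=.
    have -> : an n x *: s n x - a x *: G x = an n x *: (s n x - G x) + (an n x - a x) *: G x.
      by rewrite scalerBr scalerBl addrA subrK.
    rewrite -!(normHZ gaussian) ?normHD//; do ?[exact: CMZ]; do ?[exact: CMB].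
    by apply: CMZ => //; exact: CMB.
  - exact: cvg_cst.
  - have -> : 0 = `|a x| * 0 + 0 * normH (G x) by rewrite mulr0 mul0r addr0.
    apply: cvgD; apply: cvgM => //.
    + by apply: cvg_norm.
    + by apply/norm_cvg0P/subr_cvg0.
    + exact: cvg_cst.
have /integrableP[_] := @integrable_EFinZl _ _ _ mu (K ^+ 2) _ (L2H_normH_integrable LG).
apply: le_lt_trans; apply: ge0_le_integral => //.
- by move=> x _; rewrite lee_fin sqr_ge0.
- apply/measurable_EFinP.
  rewrite (_ : (fun x => _) = (fun x : borel X => a x ^+ 2 * dotH (G x) (G x))).
    by apply: measurable_funM; [exact: measurable_funX|exact: measurable_dotH].
  by apply/funext => x; rewrite normHZ// exprMn normH_sqr real_normK ?num_real.
- apply: measurableT_comp => //; apply/measurable_EFinP; apply: measurable_funM => //.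
  by under eq_fun do rewrite normH_sqr; exact: measurable_dotH.
- move=> x _ /=; rewrite lee_fin normHZ// exprMn ger0_norm//.
  apply: le_trans (ler_norm _); rewrite ler_wpM2r ?sqr_ge0//.
  by have /andP[ax xK] := aK x; rewrite ler_pXn2r// nnegrE (le_trans ax).
Qed.

End HValued.

(** * Cylindrical functions *)

Section ChainRule.
Context (R : realType).

Lemma dual_differentiable (X : normedModType R) (l : X -> R) (x : X) :
  dual X l -> differentiable l x.
Proof.
move=> [ll lc]; pose L := GRing.isLinear.Build R X R *%R l ll.
pose l' : {linear X -> R^o} := HB.pack l L.
exact: (@linear_differentiable _ _ _ l').
Qed.

Lemma cyl_differentiable (X : normedModType R) (n : nat) (phi : 'rV[R]_n -> R)
    (l : 'I_n -> X -> R) (x : X) :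
  C1b phi -> (forall i, dual X (l i)) ->
  differentiable (fun x => phi (\row_i l i x)) x.
Proof.
move=> [dphi _ _ _] dl.
apply: (@differentiable_comp _ _ _ _ (fun x : X => \row_i l i x) phi) => //.
rewrite (_ : (fun x : X => _) =
  (\sum_(i < n) (fun x : X => l i x *: (delta_mx 0 i : 'rV[R]_n)))); last first.
  apply/funext => y; rewrite fct_sumE; apply/rowP => j; rewrite mxE summxE.
  rewrite (bigD1 j)//= !mxE !eqxx mulr1 big1 ?addr0// => i ij.
  by rewrite !mxE [j == i]eq_sym (negbTE ij) andbF mulr0.
apply: differentiable_sum => i; apply: differentiableZl.
exact: dual_differentiable.
Qed.

Lemma FC1b_differentiable (X : completeNormedModType R) (f : X -> R) (x : X) :
  FC1b f -> differentiable f x.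
Proof.
move=> [n [phi [l [dphi dl fE]]]].
by rewrite (funext fE); exact: cyl_differentiable.
Qed.

Lemma diff_comp_real (V : normedModType R) (f : V -> R) (q q' : R -> R) (x h : V) :
  (forall y : R, is_derive y (1 : R) q (q' y)) -> differentiable f x ->
  'd (q \o f) x h = q' (f x) * 'd f x h.
Proof.
move=> dq df; have dqf : differentiable q (f x).
  by apply/derivable1_diffP; have [] := dq (f x).
rewrite diff_comp//= diff1E//= derive1E.
by have [_ ->] := dq (f x); rewrite mulrC.
Qed.

(** A linear bound on [q] is enough, since [phi] is bounded. *)
Lemma C1b_comp (n : nat) (phi : 'rV[R]_n -> R) (q q' : R -> R) (K : R) :
  (forall y : R, is_derive y (1 : R) q (q' y)) -> continuous q' ->
  (forall y, `|q' y| <= K) -> (forall y, `|q y| <= K * `|y|) ->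
  C1b phi -> C1b (q \o phi).
Proof.
move=> dq cq' q'K qK [dphi [M Mphi] cphi [M' M'phi]].
have K0 : 0 <= K by exact: le_trans (q'K 0).
have dE v w : 'd (q \o phi) v w = q' (phi v) * 'd phi v w by exact: diff_comp_real.
split.
- move=> v; apply: differentiable_comp => //.
  by apply/derivable1_diffP; have [] := dq (phi v).
- exists (K * M) => v; apply: le_trans (qK _) _.
  by rewrite ler_wpM2l.
- move=> w; rewrite (_ : (fun v => _) = (fun v => q' (phi v) * 'd phi v w)).
    move=> v; have cq : {for v, continuous (q' \o phi)}.
      apply: continuous_comp; last exact: cq'.
      exact: (differentiable_continuous (dphi v)).
    exact: cvgM cq (cphi w v).
  by apply/funext => v; exact: dE.
- exists (K * M') => v w; rewrite dE normrM -mulrA.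
  by rewrite ler_pM.
Qed.

End ChainRule.

(** * Dissipativity of the Ornstein-Uhlenbeck operator *)

Section Dissipativity.
Context (R : realType) (X : completeNormedModType R).
Variable gamma : probability (borel X) R.
Hypothesis gaussian : gaussian_measure gamma.
Variables (Om : set X) (oOm : open Om).
Let mu : {measure set (borel X) -> \bar R} := gamma_on gamma oOm.
Variable c : R.
Hypothesis c0 : 0 <= c.
Local Notation CM := (cameron_martin gamma).
Local Notation dotH := (dotH gamma).
Local Notation normH := (normH gamma).

Lemma gamma_on_lty : (mu setT < +oo)%E.
Proof.
rewrite -[mu setT]/(gamma (setT `&` Om)) setTI; apply: le_lt_trans (ltry 1).
exact: probability_le1 (open_borel oOm).
Qed.

Lemma shifted_penalty_is_derive (y : R) :
  is_derive y (1 : R) (fun z => penalty' (z - c)) (penalty'' (y - c)).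
Proof.
have dB : is_derive y (1 : R) (fun z : R => z - c) 1.
  by rewrite -[X in is_derive _ _ _ X]subr0; exact: is_deriveB.
have := @is_derive1_comp R (@penalty' R) (fun z => z - c) y _ _
  (penalty'_is_derive (y - c)) dB.
by rewrite mulr1.
Qed.

Lemma shifted_penalty''_continuous : continuous (fun y : R => penalty'' (y - c)).
Proof.
move=> y; apply: (@continuous_comp _ _ _ (fun z : R => z - c) (@penalty'' R)).
  by apply: cvgB => //; exact: cvg_cst.
exact: penalty''_continuous.
Qed.

Lemma FC1b_continuous (f : X -> R) : FC1b f -> continuous f.
Proof. by move=> ff x; apply: differentiable_continuous; exact: FC1b_differentiable. Qed.

Lemma FC1b_L2 (f : X -> R) : FC1b f -> L2 mu f.
Proof.
move=> ff; have mf : measurable_fun setT (f : borel X -> R).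
  by apply: continuous_borel_measurable; exact: FC1b_continuous.
have [n [phi [l [[_ [M Mphi] _ _] _ fE]]]] := ff.
apply: (L2_dominated mf (L2_cst M gamma_on_lty)) => x.
have H := Mphi (\row_i l i x); rewrite -fE in H.
have M0 : 0 <= M by exact: le_trans H.
by rewrite -real_normK ?num_real// ler_pXn2r ?nnegrE.
Qed.

Lemma FC1b_penalty (f : X -> R) : FC1b f -> FC1b (fun x => penalty' (f x - c)).
Proof.
move=> [n [phi [l [Cphi dl fE]]]].
exists n, ((fun z => penalty' (z - c)) \o phi), l; split; last 2 first.
- exact: dl.
- by move=> x; rewrite fE.
apply: (@C1b_comp _ _ _ _ (fun z => penalty'' (z - c)) 2 _ _ _ _ Cphi).
- exact: shifted_penalty_is_derive.
- exact: shifted_penalty''_continuous.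
- by move=> y; have /andP[? ?] := penalty''_bounds (y - c); rewrite ger0_norm.
- by move=> y; exact: penalty'_le_norm.
Qed.

Lemma cyl_grad_penalty (f : X -> R) (G : X -> X) : cyl_grad gamma oOm f G ->
  cyl_grad gamma oOm (fun x => penalty' (f x - c)) (fun x => penalty'' (f x - c) *: G x).
Proof.
move=> [ff LG fG]; split; first exact: FC1b_penalty.
  apply: (@L2H_scale _ _ _ gaussian _ (fun x => penalty'' (f x - c)) 2) => //; last first.
    by move=> x; exact: penalty''_bounds.
  apply: continuous_borel_measurable => x.
  apply: (@continuous_comp _ _ _ f (fun y => penalty'' (y - c))).
    exact: FC1b_continuous.
  exact: shifted_penalty''_continuous.
move=> x Ox; have [HG GE] := fG x Ox; split; first exact: CMZ.
move=> h Hh; rewrite dotHZ// GE//.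
rewrite -(diff_comp_real h shifted_penalty_is_derive (FC1b_differentiable x ff)).
by [].
Qed.

Lemma normH0 : normH 0 = 0.
Proof. by have := normHZ gaussian 0 (CM0 gaussian); rewrite scale0r normr0 mul0r. Qed.

(** The constant sequence is an approximating sequence. *)
Lemma cyl_sobolev_grad (f : X -> R) (G : X -> X) : cyl_grad gamma oOm f G ->
  sobolev_grad gamma oOm f G.
Proof.
move=> fG; have [ff LG _] := fG; split => //; first exact: FC1b_L2.
exists (fun=> f), (fun=> G); split => //.
  rewrite (_ : (fun _ : nat => _) = fun=> 0%E); first exact: cvg_cst.
  apply/funext => n; rewrite (_ : (fun x => _) = (fun=> 0)).
    by rewrite L2normE; [rewrite ae_eq0_nrm//; [exact: L2_cst0|exact: ae_eq_refl]|exact: L2_cst0].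
  by apply/funext => x; rewrite subrr.
rewrite (_ : (fun _ : nat => _) = fun=> 0%E); first exact: cvg_cst.
apply/funext => n; under eq_integral do rewrite subrr normH0 expr0n/=.
exact: integral0.
Qed.

(** Polarization: [<h, k> >= - |k - h|^2 / 4], because [|h + k|^2 >= 0]. *)
Lemma dotH_polar (h k : X) (a : R) : CM h -> CM k -> 0 <= a <= 2 ->
  - (a * dotH h k) <= 2^-1 * normH (k - h) ^+ 2.
Proof.
move=> Hh Hk /andP[a0 a2].
have := sqr_ge0 (normH (k - h)); have := sqr_ge0 (normH (h + k)).
rewrite (normHB_sqr gaussian Hk Hh) (normHD_sqr gaussian Hh Hk) (dotHC _ k h).
move: (normH h ^+ 2) (normH k ^+ 2) (dotH h k) => A B s ? ?.
have [s0|s0] := leP 0 s; first by have := mulr_ge0 a0 s0; lra.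
have : a * - s <= 2 * - s by rewrite ler_wpM2r// oppr_ge0 ltW.
by rewrite mulrN; lra.
Qed.

(** Testing the weak equation with the cylindrical functions
    [penalty' (f_n - c)], where [f_n] approximates [u], avoids any chain rule
    in the Sobolev space. *)
Lemma ou_dissipative (u g : X -> R) : ou_operator gamma oOm u g ->
  ip mu (fun x => penalty' (u x - c)) g <= 0.
Proof.
move=> [Lg [F [Lu LF [f [G [fG fu GF]]]] uF]].
have Lf n : L2 mu (f n) by apply: FC1b_L2; have [] := fG n.
have HF x : CM (F x) by have [] := LF.
have LG n : L2H gamma mu (G n) by have [] := fG n.
have HG n x : CM (G n x) by have [] := LG n.
pose D n := \int[mu]_x (normH (G n x - F x) ^+ 2).
have iD n : mu.-integrable setT (fun x : borel X => (normH (G n x - F x) ^+ 2)%:E).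
  have i1 := L2H_normH_integrable gaussian (LG n).
  have i2 := integrable_EFinZl 2 (L2H_dotH_integrable gaussian (LG n) LF).
  have i3 := L2H_normH_integrable gaussian LF.
  have := integrableD measurableT (integrableB measurableT i1 i2) i3.
  apply: eq_integrable => // x _; rewrite /= normHB_sqr//.
have test n : ip mu (fun x => penalty' (f n x - c)) g <= 2^-1 * D n.
  have cg := cyl_grad_penalty (fG n).
  have /eqP := uF _ _ (cyl_sobolev_grad cg).
  rewrite -eqr_oppLR => /eqP E; have [_ LaG _] := cg.
  have i1 := integrable_EFinZl (-1) (L2H_dotH_integrable gaussian LF LaG).
  rewrite ipC {1}/ip -E -mulN1r -RintegralZl//; last first.
    exact: (L2H_dotH_integrable gaussian LF LaG).
  rewrite /D -RintegralZl//; last exact: iD.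
  apply: (le_Rintegral measurableT i1 (integrable_EFinZl _ (iD n))).
  move=> x _; rewrite mulN1r [dotH (F x) _]dotHC dotHZ// (dotHC _ (G n x)).
  by apply: dotH_polar => //; exact: penalty''_bounds.
have Dlim e : 0 < e -> exists N, forall n, (N <= n)%N -> D n <= e.
  have D0 : D n @[n --> \oo] --> 0 by exact: (fine_cvg GF).
  move=> e0; have /cvgrPdist_le/(_ e e0)[N _ NP] := D0.
  exists N => n /NP /=; rewrite sub0r normrN; exact: le_trans (ler_norm _).
have flim e : 0 < e -> exists N, forall n, (N <= n)%N -> nrm mu (fun x => u x - f n x) <= e.
  have f0 : fine (L2norm mu (fun x => f n x - u x)) @[n --> \oo] --> 0.
    by exact: (fine_cvg fu).
  move=> e0; have /cvgrPdist_le/(_ e e0)[N _ NP] := f0.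
  exists N => n /NP /=; rewrite sub0r normrN L2normE; last exact: L2B.
  rewrite (_ : (fun x => f n x - u x) = (fun x => -1 * (u x - f n x))).
    by rewrite nrmZ ?normrN1 ?mul1r; [exact: le_trans (ler_norm _)|exact: L2B].
  by apply/funext => x; rewrite mulN1r opprB.
apply/ler_addgt0Pr => e e0; rewrite add0r.
have ng := nrm_ge0 mu g.
have [N1 N1P] := Dlim _ e0.
have e1 : 0 < e / (4 * (nrm mu g + 1)) by apply: divr_gt0 => //; lra.
have [N2 N2P] := flim _ e1.
pose n := maxn N1 N2.
have Dn := N1P n (leq_maxl _ _); have fn := N2P n (leq_maxr _ _).
have Lqf := penalty'_L2 c0 (Lf n); have Lqu := penalty'_L2 c0 Lu.
have := test n.
have := le_trans (ler_norm _) (ip_le_nrm (L2B Lqu Lqf) Lg).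
rewrite ipB//.
have : nrm mu (fun x => penalty' (u x - c) - penalty' (f n x - c)) * nrm mu g <=
    2 * (e / (4 * (nrm mu g + 1))) * nrm mu g.
  rewrite ler_wpM2r//; apply: le_trans (nrm_penalty'_lip c0 Lu (Lf n)) _.
  by rewrite ler_pM2l.
have : 2 * (e / (4 * (nrm mu g + 1))) * nrm mu g <= e / 2.
  rewrite (_ : _ * _ * _ = (e / 2) * (nrm mu g / (nrm mu g + 1))); last first.
    by field; rewrite gt_eqF//; lra.
  rewrite ler_piMr ?divr_ge0 ?(ltW e0)// ler_pdivrMr; lra.
lra.
Qed.

End Dissipativity.

(** * Sub-markovian semigroups on square-integrable functions *)

Lemma at_right0_cvg0 (R : realType) (k : R -> \bar R) (n : R -> R) :
  (forall h, 0 < h -> k h = (n h)%:E) -> (forall h, 0 < h -> 0 <= n h) ->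
  (k h @[h --> 0^'+] --> 0%E) <->
  (forall e, 0 < e -> exists2 r, 0 < r & forall h, 0 < h -> h < r -> n h <= e).
Proof.
move=> kn n0; split=> [k0 e e0|H].
  have f0 : fine (k h) @[h --> 0^'+] --> (0 : R) by exact: (fine_cvg k0).
  have /cvgrPdist_le/(_ e e0)[r /= r0 rP] := f0.
  exists r => // h h0 hr; have := rP h; rewrite /= sub0r normrN gtr0_norm//.
  move=> /(_ hr h0); rewrite sub0r normrN kn//=; exact: le_trans (ler_norm _).
apply/fine_cvgP; split.
  by near=> h; rewrite kn//.
apply/cvgrPdist_le => e e0; have [r r0 rP] := H e e0.
near=> h; have h0 : 0 < h by [].
rewrite sub0r normrN /= kn//= ger0_norm ?n0//; apply: rP => //.
Unshelve. all: by end_near. Qed.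

Section L2Semigroup.
Context d (T : measurableType d) (R : realType).
Variable mu : {measure set T -> \bar R}.
Variables (A : (T -> R) -> (T -> R) -> Prop) (S : R -> (T -> R) -> (T -> R)).
Hypothesis sg : C0_contraction_semigroup_generated_by mu A S.

Local Notation V := (LfunType mu (lee1n 2)).
Definition nrmL (f : V) : R := nrm mu f.

Lemma LfunType_L2 (f : V) : L2 mu f.
Proof. exact: LfunP. Qed.

(** The semigroup on the bundled type of L^2 functions. The maps [S t] preserve
    L^2 for [0 <= t] only, whence the case distinction. *)
Definition semL (t : R) (f : V) : V :=
  match pselect (0 <= t) with
  | left t0 => Lfun_Sub (lee1n 2) (sg_L2 sg t0 (LfunType_L2 f))
  | right _ => f
  end.

Lemma semLE t f : 0 <= t -> (semL t f : T -> R) = S t f.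
Proof.
by move=> t0; rewrite /semL; case: pselect => // t0'; rewrite Lfun_valP.
Qed.

Lemma nrmL_ae0 (f g : V) : (f : T -> R) = g %[ae mu] -> nrmL (f - g) = 0.
Proof.
move=> fg; apply: ae_eq0_nrm; first exact: LfunType_L2.
apply: filterS fg => x /(_ I) fgx _.
by rewrite -[LHS]/(f x - g x) fgx subrr.
Qed.

Lemma nrmL_complete : complete_seminorm nrmL.
Proof.
split.
- by move=> a x; rewrite /nrmL -nrmZ//; exact: LfunType_L2.
- by move=> x y; apply: nrmD; exact: LfunType_L2.
move=> f cf.
have [g Lg gP] := L2_complete (fun n => LfunType_L2 (f n)) cf.
exists (Lfun_Sub (lee1n 2) Lg) => e /gP[M MP]; exists M => n /MP.
by rewrite /nrmL Lfun_valP.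
Qed.

Lemma semL_contraction_semigroup : contraction_semigroup nrmL semL.
Proof.
have L := LfunType_L2.
split.
- move=> t a x y t0; apply: nrmL_ae0.
  have := sg_linear sg a t0 (L x) (L y).
  by apply: filterS => z /(_ I) H _; rewrite !semLE// H /= !semLE.
- move=> t x t0; rewrite -lee_fin -!L2normE//; rewrite semLE//.
  exact: (sg_contraction sg).
- move=> x; apply: nrmL_ae0; rewrite semLE//; exact: (sg_0 sg).
- move=> s t x s0 t0; apply: nrmL_ae0; rewrite !semLE ?addr_ge0//; exact: (sg_D sg).
move=> x e e0.
have k h : 0 < h -> L2norm mu (fun p => S h x p - x p) = (nrmL (semL h x - x))%:E.
  move=> h0; rewrite -L2normE//; congr L2norm.
  by rewrite -semLE// ltW.
have [r r0 rP] := (at_right0_cvg0 k (fun _ _ => nrm_ge0 _ _)).1 (sg_continuous sg (L x)) e e0.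
by exists r.
Qed.

Lemma semL_generator (u g : V) : is_generator nrmL semL u g -> A u g.
Proof.
have L := LfunType_L2.
move=> ug; apply/(sg_generator sg (L u) (L g)).
have k h : 0 < h -> L2norm mu (fun x => h^-1 * (S h u x - u x) - g x) =
    (h^-1 * nrmL (semL h u - u - h *: g))%:E.
  move=> h0; rewrite -[h^-1 in RHS]gtr0_norm ?invr_gt0// /nrmL -nrmZ//.
  rewrite -L2normE; last exact: L2Z.
  congr L2norm; apply/funext => x.
  rewrite -[RHS]/(h^-1 * (semL h u x - u x - h * g x)) semLE ?ltW//.
  by field; rewrite gt_eqF.
apply/(at_right0_cvg0 k); first by move=> h h0; rewrite mulr_ge0 ?invr_ge0 ?nrm_ge0// ltW.
move=> e /ug[r r0 rP]; exists r => // h h0 hr.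
by rewrite ler_pdivrMl// mulrC; exact: rP.
Qed.

(** The upper bound [c] is preserved, because the penalty of the excess over [c]
    cannot increase. *)
Lemma semigroup_le_cst (c : R) (phi : T -> R) (t : R) : 0 <= c ->
  (forall u g, L2 mu u -> L2 mu g -> A u g ->
     ip mu (fun x => penalty' (u x - c)) g <= 0) ->
  L2 mu phi -> 0 <= t ->
  {ae mu, forall x, phi x <= c} -> {ae mu, forall x, S t phi x <= c}.
Proof.
have L := LfunType_L2.
move=> c0 dissipative Lphi t0 phic.
pose W (u : V) := \int[mu]_x penalty (u x - c).
pose Q (y z : V) := ip mu (fun x => penalty' (y x - c)) z.
pose f : V := Lfun_Sub (lee1n 2) Lphi.
have fE : (f : T -> R) = phi by rewrite /f Lfun_valP.
have Lq (y : V) : L2 mu (fun x => penalty' (y x - c)) by exact: penalty'_L2.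
have WS : W (semL t f) <= W f.
  apply: (@lyapunov_semigroup _ _ nrmL semL nrmL_complete
    semL_contraction_semigroup W Q 2) => //.
  - by move=> x y; apply: penalty_integral_convex.
  - by move=> y a z z'; exact: (ip_linr a (L z) (L z') (Lq y)).
  - move=> y z; apply: le_trans (ip_le_nrm (Lq y) (L z)) _.
    by rewrite ler_wpM2r ?nrm_ge0// nrm_penalty'_le.
  - move=> x y z; rewrite /Q -ipB//.
    apply: le_trans (ip_le_nrm (L2B (Lq y) (Lq x)) (L z)) _.
    by rewrite ler_wpM2r ?nrm_ge0//; apply: nrm_penalty'_lip.
  - by move=> u g ug; apply: dissipative => //; exact: semL_generator.
have Wf : W f = 0.
  rewrite /W /Rintegral (_ : (\int[mu]_x _)%E = 0%E)//.
  rewrite -(integral0 mu setT); apply: ae_eq_integral => //.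
    by have /integrableP[] := penalty_integrable c0 (L f).
  apply: filterS phic => x xc _ /=.
  by rewrite penalty_neg// subr_le0.
have i1 := penalty_integrable c0 (L (semL t f)).
have W0 : (\int[mu]_x (penalty (semL t f x - c))%:E = 0)%E.
  rewrite -(fineK (integrable_fin_num measurableT i1)); congr EFin.
  apply: le_anti; rewrite -{1}Wf WS/=.
  by apply: Rintegral_ge0 => x _; exact: penalty_ge0.
have [mp _] := integrableP _ _ _ i1.
have : ae_eq mu setT (EFin \o (fun x => penalty (semL t f x - c))) (cst 0%E).
  apply/(ae_eq_integral_abs mu measurableT mp).
  rewrite -W0; apply: eq_integral => x _.
  by rewrite /= ger0_norm// penalty_ge0.
apply: filterS => x /(_ I) /= [] /penalty_eq0.
by rewrite semLE// fE subr_le0.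
Qed.

Lemma semigroup_sub_markovian (phi : T -> R) (t : R) :
  (forall c, 0 <= c -> forall u g, L2 mu u -> L2 mu g -> A u g ->
     ip mu (fun x => penalty' (u x - c)) g <= 0) ->
  L2 mu phi -> 0 <= t ->
  {ae mu, forall x, 0 <= phi x <= 1} -> {ae mu, forall x, 0 <= S t phi x <= 1}.
Proof.
move=> diss Lphi t0 phi01.
have le1 : {ae mu, forall x, S t phi x <= 1}.
  apply: (semigroup_le_cst ler01 (diss 1 ler01)) => //.
  by apply: filterS phi01 => x /andP[].
(* [- phi] in the form that [sg_linear] handles *)
have ge0 : {ae mu, forall x, S t (fun y => -2 * phi y + phi y) x <= 0}.
  apply: (semigroup_le_cst (lexx 0) (diss 0 (lexx 0))) => //.
    exact: L2_lin.
  by apply: filterS phi01 => x /andP[p0 _]; lra.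
have lin := sg_linear sg (-2) t0 Lphi Lphi.
apply: filterS3 le1 ge0 lin => x -> + /(_ I) SE.
by rewrite SE andbT => H; lra.
Qed.

End L2Semigroup.

(** A null set of the restricted measure is a null set up to points outside
    [Om]. *)
Lemma ae_gamma_on (R : realType) (X : completeNormedModType R)
    (gamma : probability (borel X) R) (Om : set X) (oOm : open Om) (P : X -> Prop) :
  {ae gamma, forall x, Om x -> P x} <-> 
  {ae (gamma_on gamma oOm : {measure set (borel X) -> \bar R}), forall x, P x}.
Proof.
have mOm := open_borel oOm.
split=> -[N [mN N0 NP]].
  exists (N `|` ~` Om); split.
  - by apply: measurableU => //; exact: measurableC.
  - rewrite -[LHS]/(gamma ((N `|` ~` Om) `&` Om)) setIUl setICl setU0.
    by apply: (subset_measure0 _ _ _ N0) => //; exact: measurableI.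
  - move=> x /= nP; have [Ox|] := pselect (Om x); last by right.
    by left; apply: NP => /(_ Ox).
exists (N `&` Om); split => //; first exact: measurableI.
move=> x /= /not_implyP[Ox nP]; split => //; exact: NP.
Qed.

Theorem lemma1p1 (R : realType) (X : completeNormedModType R)
    (gamma : probability (borel X) R) (Om : set X) (oOm : open Om)
    (T : R -> (X -> R) -> (X -> R)) :
  infinite_dimensional X ->
  separable_space X ->
  gaussian_measure gamma ->
  centered_measure gamma ->
  nondegenerate_measure gamma ->
  C0_contraction_semigroup_generated_by (gamma_on gamma oOm)
    (ou_operator gamma oOm) T ->
  forall phi : X -> R, L2 (gamma_on gamma oOm) phi ->
  {ae gamma, forall x, Om x -> 0 <= phi x <= 1} ->
  forall t : R, 0 <= t ->
  {ae gamma, forall x, Om x -> 0 <= T t phi x <= 1}.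
Proof.
move=> _ _ gaussian _ _ sg phi Lphi /(ae_gamma_on _ oOm) phi01 t t0.
apply/(ae_gamma_on _ oOm).
apply: (semigroup_sub_markovian sg _ Lphi t0 phi01) => c c0 u g _ _.
exact: ou_dissipative.
Qed.
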